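(* Let $\underline{\mathcal C}:\mathbf{Bij}^{op}\to\mathbf{Set}$ be a functor. Then $\underline{\mathcal C}$ can be endowed with a cyclic operad structure (units ${\it id}_{x,y}$ and partial compositions ${}_x\circ_y$ satisfying (A1), (CO), (EQ), (U1), (U3)) if and only if $\underline{\mathcal C}$ can be endowed with a structure morphism $\delta:\mathcal M(\underline{\mathcal C})\to\underline{\mathcal C}$ of an algebra over the monad of unrooted trees $(\mathcal M,\mu,\eta)$.
   Context: CONVENTIONS. Fix an infinite set $V$ of variables; ''finite set'' means finite subset of $V$, and $\mathbf{Bij}$ is the category of finite sets and bijections. For a functor $\underline{\mathcal C}:\mathbf{Bij}^{op}\to\mathbf{Set}$, $f\in\underline{\mathcal C}(X)$ and a bijection $\sigma:X'\to X$, write $f^\sigma=\underline{\mathcal C}(\sigma)(f)\in\underline{\mathcal C}(X')$. For $Y\subseteq X$, $\sigma|^Y:\sigma^{-1}(Y)\to Y$ is the corestriction. If $x\in X$ and $z\notin X\setminus\{x\}$, the bijection $(X\setminus\{x\})\cup\{z\}\to X$ that is the identity on $X\setminus\{x\}$ and sends $z$ to $x$ is said to rename $x$ to $z$. CYCLIC OPERAD STRUCTURE on $\underline{\mathcal C}$: an element ${\it id}_{x,y}={\it id}_{y,x}\in\underline{\mathcal C}(\{x,y\})$ for each two-element set $\{x,y\}$, and maps ${}_x\circ_y:\underline{\mathcal C}(X)\times\underline{\mathcal C}(Y)\to\underline{\mathcal C}(X\setminus\{x\}\cup Y\setminus\{y\})$ for all $X,Y$, $x\in X$, $y\in Y$ with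 $(X\setminus\{x\})\cap(Y\setminus\{y\})=\emptyset$, such that (whenever all compositions involved are defined), for $f\in\underline{\mathcal C}(X)$, $g\in\underline{\mathcal C}(Y)$, $h\in\underline{\mathcal C}(Z)$: (A1) $(f\,{}_x\circ_y\,g)\,{}_u\circ_z\,h=f\,{}_x\circ_y\,(g\,{}_u\circ_z\,h)$ for $x\in X$, $y\neq u\in Y$, $z\in Z$; (CO) $f\,{}_x\circ_y\,g=g\,{}_y\circ_x\,f$; (EQ) $f^{\sigma_1}\,{}_{\sigma_1^{-1}(x)}\circ_{\sigma_2^{-1}(y)}\,g^{\sigma_2}=(f\,{}_x\circ_y\,g)^{\sigma}$ for bijections $\sigma_1:X'\to X$, $\sigma_2:Y'\to Y$ and $\sigma=\sigma_1|^{X\setminus\{x\}}\cup\sigma_2|^{Y\setminus\{y\}}$; (U1) $f\,{}_x\circ_y\,{\it id}_{y,z}=f^\sigma$, where $\sigma$ renames $x$ to $z$; (U3) ${\it id}_{x,y}^{\sigma}={\it id}_{u,v}$ for every bijection $\sigma:\{u,v\}\to\{x,y\}$. TREES over a functor $\underline{\mathcal C}$. An ordinary corolla is a term $a(x_1,\dots,x_n)$ with $a\in\underline{\mathcal C}(X)$, $X=\{x_1,\dots,x_n\}$ (order of variables irrelevant; $a$ is called a parameter); its set of free variables is $FV(a)=X$. A special corolla is a term $(x,y)=(y,x)$ with $x\ne y$ in $V$ and no parameter; $FV((x,y))=\{x,y\}$. A graph $\mathcal T=\{\text{corollas};\sigma\}$ is a non-empty finite set ${\it Cor}(\mathcal T)$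 of corollas with mutually disjoint free variables, with an involution $\sigma$ on the set $V(\mathcal T)$ of all their variables. Its edges are the pairs $\{x,\sigma(x)\}$ with $\sigma(x)\neq x$ (joining the corollas containing $x$ and $\sigma(x)$); $FV(\mathcal T)$ is the set of fixpoints of $\sigma$. An extended unrooted tree is a connected graph without loops, multiple edges and cycles. It is an ordinary unrooted tree if all corollas are ordinary, an exceptional unrooted tree if it consists of exactly one special corolla $\{(x,y);{\it id}_{\{x,y\}}\}$, and an unrooted tree if it is ordinary or exceptional. Two extended unrooted trees are $\alpha$-equivalent if one is obtained from the other by renaming variables that are not fixpoints of the involution (to fresh distinct variables), replacing each ordinary corolla $a$ by $a^{\tau}$ with $\tau$ the corresponding renaming bijection, and transporting the involution. $\mathtt T_{\underline{\mathcal C}}(X)$ (resp. $\mathtt{eT}_{\underline{\mathcal C}}(X)$) is the set of $\alpha$-classes $[\mathcal T]_\alpha$ of unrooted trees (resp. extended unrooted trees) with $FV(\mathcal T)=X$. These are functors $\mathbf{Bij}^{op}\to\mathbf{Set}$: for $\kappa:X'\to X$, $[\mathcal T]_\alpha^\kappa$ is obtained by renaming each free variable $x$ to $\kappa^{-1}(x)$ (after renaming non-free variables away from $X'$), changing parameters accordingly. NORMAL FORMS. On $\mathtt{eT}_{\underline{\mathcal C}}$ consider the one-step reductions (on representatives): $\{a(x_1,\dots,x_i,\dots,x_n),(y,z),\dots;\sigma\}\to\{a^{\tau}(x_1,\dots,z,\dots,x_n),\dots;\sigma'\}$ if $\sigma(x_i)=y$, where $\tau$ renames $x_i$ to $z$;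 and $\{(x,y),(u,v),\dots;\sigma\}\to\{(x,v),\dots;\sigma'\}$ if $\sigma(y)=u$; in both cases $\sigma'$ is the restriction of $\sigma$ to the remaining variables. This system is terminating and confluent with normal forms exactly the classes of unrooted trees, giving ${\it nf}_X:\mathtt{eT}_{\underline{\mathcal C}}(X)\to\mathtt T_{\underline{\mathcal C}}(X)$. FLATTENING. ${\it flat}_X:\mathtt T_{\mathtt T_{\underline{\mathcal C}}}(X)\to\mathtt{eT}_{\underline{\mathcal C}}(X)$ is the identity on exceptional trees. For an ordinary tree with corollas given by parameters $[\mathcal T_i]_\alpha\in\mathtt T_{\underline{\mathcal C}}(Y_i)$, $1\le i\le n$, and involution $\sigma$ on $\bigcup_iY_i$, choose representatives $\mathcal T_i$ (with involutions $\sigma_i$) with pairwise disjoint variable sets; the result is the class of the extended tree with corollas $\bigcup_i{\it Cor}(\mathcal T_i)$ and involution $\underline\sigma$ with $\underline\sigma(x)=\sigma(x)$ if $x\in\bigcup_iFV(\mathcal T_i)$, $\underline\sigma(x)=\sigma_i(x)$ if $x\in V(\mathcal T_i)\setminus FV(\mathcal T_i)$. MONAD OF UNROOTED TREES on $\mathbf{Set}^{\mathbf{Bij}^{op}}$: $\mathcal M(\underline{\mathcal C})=\mathtt T_{\underline{\mathcal C}}$ (on morphisms: apply the natural transformation to each parameter); $\eta_{\underline{\mathcal C},X}(a)=[\{a(x_1,\dots,x_n);{\it id}_X\}]_\alpha$ for $X=\{x_1,\dots,x_n\}$; $\mu_{\underline{\mathcal C},X}={\it nf}_X\circ{\it flat}_X$.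 An $\mathcal M$-algebra structure on $\underline{\mathcal C}$ is a natural transformation $\delta:\mathcal M(\underline{\mathcal C})\to\underline{\mathcal C}$ with $\delta\circ\mathcal M\delta=\delta\circ\mu_{\underline{\mathcal C}}$ and $\delta\circ\eta_{\underline{\mathcal C}}={\it id}$. *)

(* Defs.v *)
From HB Require Import structures.
From mathcomp Require Import all_boot finmap.
From mathcomp Require Import boolp classical_sets cardinality.

Set Implicit Arguments.
Unset Strict Implicit.
Unset Printing Implicit Defensive.

Local Open Scope fset_scope.

Section Bijections.

Variable V : choiceType.
Implicit Types X Y Z : {fset V}.

Record bij X Y := Bij {
  bij_fun :> X -> Y;
  bij_inv : Y -> X;
  bijK : cancel bij_fun bij_inv;
  bij_invK : cancel bij_inv bij_fun }.

Lemma bijP X Y (s t : bij X Y) : s =1 t -> s = t.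
Proof.
case: s t => [f f' fK f'K] [g g' gK g'K] /= /funext fg; subst g.
have e : f' = g' by apply/funext => y; rewrite -{1}(g'K y) fK.
by subst g'; congr Bij; apply: Prop_irrelevance.
Qed.

Definition bij_id X : bij X X :=
  @Bij X X id id (fun=> erefl) (fun=> erefl).

Definition bij_comp X Y Z (s : bij Y Z) (t : bij X Y) : bij X Z :=
  @Bij X Z (s \o t) (bij_inv t \o bij_inv s)
    (can_comp (bijK s) (bijK t)) (can_comp (bij_invK t) (bij_invK s)).

End Bijections.

Section Species.

Variable V : choiceType.
Implicit Types X Y Z : {fset V}.

Record species := Species {
  sp_obj :> {fset V} -> Type;
  sp_map : forall X' X, bij X' X -> sp_obj X -> sp_obj X';
  sp_map_id : forall X (f : sp_obj X), sp_map (bij_id X) f = f;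
  sp_map_comp : forall X'' X' X (s : bij X' X) (t : bij X'' X') (f : sp_obj X),
    sp_map (bij_comp s t) f = sp_map t (sp_map s f) }.

Record nat_trans (C D : species) := NatTrans {
  nt_fun :> forall X, C X -> D X;
  nt_nat : forall X' X (s : bij X' X) (f : C X),
    nt_fun (sp_map s f) = sp_map s (nt_fun f) }.

End Species.

Arguments sp_map {V C X' X} s f : rename.
Notation "f ^^ s" := (sp_map s f) (at level 20, left associativity).

(* The equation a = b between elements of the sets C X and C Y, where X and Y
   are equal as finite sets but not convertible. *)
Notation "a =~ b" := (Tagged (sp_obj _) a = Tagged (sp_obj _) b)
  (at level 70, no associativity).

Section CyclicOperad.

Variable V : choiceType.
Implicit Types (X Y Z : {fset V}) (x y z u : V).

Definition renames X x z (s : bij ((X `\ x) `|` [fset z]) X) : Prop :=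
  forall v, val (s v) = if val v == z then x else val v.

(* [s] is the union of the corestrictions of [s1] and [s2]. *)
Definition glues X Y X' Y' x y (s1 : bij X' X) (s2 : bij Y' Y) (x' y' : V)
    (s : bij ((X' `\ x') `|` (Y' `\ y')) ((X `\ x) `|` (Y `\ y))) : Prop :=
  (forall v (w : X'), val v = val w -> val w != x' -> val (s v) = val (s1 w)) /\
  (forall v (w : Y'), val v = val w -> val w != y' -> val (s v) = val (s2 w)).

Record cyclic_operad (C : species V) := CyclicOperad {
  co_id : forall X, #|` X| == 2 -> C X;
  co_comp : forall X Y x y, x \in X -> y \in Y ->
    [disjoint X `\ x & Y `\ y] -> C X -> C Y -> C ((X `\ x) `|` (Y `\ y));
  co_A1 : forall X Y Z x y u z (f : C X) (g : C Y) (h : C Z)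
    (xX : x \in X) (yY : y \in Y) (uY : u \in Y) (zZ : z \in Z)
    (dXY : [disjoint X `\ x & Y `\ y])
    (uXY : u \in (X `\ x) `|` (Y `\ y))
    (dXYZ : [disjoint ((X `\ x) `|` (Y `\ y)) `\ u & Z `\ z])
    (dYZ : [disjoint Y `\ u & Z `\ z])
    (yYZ : y \in (Y `\ u) `|` (Z `\ z))
    (dX_YZ : [disjoint X `\ x & ((Y `\ u) `|` (Z `\ z)) `\ y]),
    y != u ->
    co_comp uXY zZ dXYZ (co_comp xX yY dXY f g) h =~
    co_comp xX yYZ dX_YZ f (co_comp uY zZ dYZ g h);
  co_CO : forall X Y x y (f : C X) (g : C Y) (xX : x \in X) (yY : y \in Y)
    (dXY : [disjoint X `\ x & Y `\ y]) (dYX : [disjoint Y `\ y & X `\ x]),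
    co_comp xX yY dXY f g =~ co_comp yY xX dYX g f;
  co_EQ : forall X Y X' Y' (s1 : bij X' X) (s2 : bij Y' Y) (x : X) (y : Y)
    (f : C X) (g : C Y)
    (dXY : [disjoint X `\ val x & Y `\ val y])
    (dXY' : [disjoint X' `\ val (bij_inv s1 x) & Y' `\ val (bij_inv s2 y)])
    (s : bij ((X' `\ val (bij_inv s1 x)) `|` (Y' `\ val (bij_inv s2 y)))
             ((X `\ val x) `|` (Y `\ val y))),
    glues s1 s2 s ->
    co_comp (valP (bij_inv s1 x)) (valP (bij_inv s2 y)) dXY'
      (f ^^ s1) (g ^^ s2) = co_comp (valP x) (valP y) dXY f g ^^ s;
  co_U1 : forall X x y z (f : C X) (xX : x \in X) (yz : y \in [fset y; z])
    (cyz : #|` [fset y; z]| == 2)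
    (d : [disjoint X `\ x & [fset y; z] `\ y])
    (s : bij ((X `\ x) `|` [fset z]) X),
    renames s -> co_comp xX yz d f (co_id cyz) =~ f ^^ s;
  co_U3 : forall X X' (cX : #|` X| == 2) (cX' : #|` X'| == 2) (s : bij X' X),
    co_id cX ^^ s = co_id cX' }.

End CyclicOperad.

Section Graphs.

Variables (V : choiceType) (C : species V).
Implicit Types (X Y : {fset V}) (x : V) (r : V -> V).

Inductive corolla :=
| Ord X of C X
| Spec X of #|` X| == 2.

Fact corolla_eqMixin : hasDecEq corolla. Proof. exact: gen_eqMixin. Qed.
HB.instance Definition _ := corolla_eqMixin.
HB.instance Definition _ := gen_choiceMixin corolla.

Definition FV (c : corolla) : {fset V} :=
  match c with Ord X _ => X | @Spec X _ => X end.

Definition is_ord (c : corolla) : bool := if c is Ord _ _ then true else false.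

(* The values of [inv] outside the variables of the corollas are irrelevant. *)
Record graph := Graph { cor : {fset corolla}; inv : V -> V }.

Implicit Types T U : graph.

Definition vars T : {fset V} := \bigcup_(c <- cor T) FV c.
Definition free T : {fset V} := [fset x in vars T | inv T x == x].

Definition is_graph T : Prop :=
  [/\ cor T != fset0,
      {in cor T &, forall c d, c != d -> [disjoint FV c & FV d]},
      {in vars T, forall x, inv T x \in vars T} &
      {in vars T, forall x, inv T (inv T x) = x}].

Definition adj T : rel corolla := fun c d =>
  [&& c \in cor T, d \in cor T &
      [exists x : FV c, (inv T (val x) \in FV d) && (inv T (val x) != val x)]].

Definition is_etree T : Prop :=
  is_graph T /\
  [/\ (* connectedness *)
      {in cor T &, forall c d, exists2 p, path (adj T) c p & d = last c p},
      (* no loops *)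
      {in cor T, forall c x, x \in FV c -> inv T x \in FV c -> inv T x = x},
      (* no multiple edges *)
      {in cor T &, forall c d x y, c != d -> x \in FV c -> y \in FV c ->
         inv T x \in FV d -> inv T y \in FV d -> x = y} &
      (* no cycles *)
      forall s, 2 < size s -> uniq s -> ~~ cycle (adj T) s].

Definition is_ordinary T : Prop := {in cor T, forall c, is_ord c}.

Definition is_exceptional T : Prop :=
  exists2 c, cor T = [fset c] & ~~ is_ord c /\ {in FV c, inv T =1 id}.

Definition is_utree T : Prop :=
  is_etree T /\ (is_ordinary T \/ is_exceptional T).

(* [c'] is obtained from [c] by renaming each free variable [x] to [r x]. *)
Definition ren_cor r (c c' : corolla) : Prop :=
  match c, c' with
  | @Ord X f, @Ord X' f' =>
      exists2 s : bij X' X, forall v, r (val (s v)) = val v & f' = f ^^ s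
  | @Spec X _, @Spec X' _ => X' = r @` X
  | _, _ => False
  end.

(* [T'] is obtained from [T] by renaming each variable [x] to [r x]. *)
Definition renaming r T T' : Prop :=
  [/\ {in vars T &, injective r},
      forall c', c' \in cor T' <-> exists2 c, c \in cor T & ren_cor r c c' &
      {in vars T, forall x, inv T' (r x) = r (inv T x)}].

Definition alpha T T' : Prop :=
  exists2 r, {in free T, r =1 id} & renaming r T T'.

Definition alpha_class T : set graph := [set T' | alpha T T'].

(* Sets of alpha-classes of the graphs T with P T and FV(T) = X. *)
Record class_of (P : graph -> Prop) X := Class {
  class_set :> set graph;
  classP : exists T, [/\ P T, free T = X & class_set = alpha_class T] }.

Definition eT X := class_of is_etree X.
Definition T_ X := class_of is_utree X.

Lemma class_inj P X (q q' : class_of P X) : q = q' :> set graph -> q = q'.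
Proof.
by case: q q' => [A a] [B b] /= AB; subst B; congr Class; apply: Prop_irrelevance.
Qed.

End Graphs.

Arguments Ord {V C X}.
Arguments Spec {V C X}.
Arguments class_set {V C P X}.

Section Transport.

Variables (V : choiceType) (C D : species V) (T : graph C) (T' : graph D).
Variables (phi : corolla C -> corolla D) (r : V -> V).
Hypothesis phi_cor : cor T' = phi @` cor T.
Hypothesis phi_FV : {in cor T, forall c, FV (phi c) = r @` FV c}.
Hypothesis r_inj : {in vars T &, injective r}.
Hypothesis r_inv : {in vars T, forall x, inv T' (r x) = r (inv T x)}.

Lemma varsP (E : species V) (U : graph E) x :
  reflect (exists2 c, c \in cor U & x \in FV c) (x \in vars U).
Proof.
apply: (iffP (bigfcupP _ _ _ _)) => [[c /andP[cU _] xc]|[c cU xc]].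
  by exists c.
by exists c; rewrite ?cU.
Qed.

Lemma FV_vars (E : species V) (U : graph E) c x :
  c \in cor U -> x \in FV c -> x \in vars U.
Proof. by move=> cU xc; apply/varsP; exists c. Qed.

Lemma transport_vars : vars T' = r @` vars T.
Proof.
apply/fsetP => y; apply/varsP/imfsetP => /=.
  case=> c'; rewrite phi_cor => /imfsetP[c /= cT ->].
  by rewrite phi_FV // => /imfsetP[x /= xc ->]; exists x => //; apply: FV_vars xc.
case=> x /varsP[c cT xc] ->; exists (phi c); first by rewrite phi_cor in_imfset.
by rewrite phi_FV // in_imfset.
Qed.

Hypothesis Tg : is_graph T.

Lemma transport_free : free T' = r @` free T.
Proof.
case: Tg => _ _ Ti _.
apply/fsetP => y; rewrite !inE /= transport_vars; apply/andP/imfsetP => /=.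
  case=> /imfsetP[x /= xT ->]; rewrite r_inv // => /eqP /r_inj e.
  by exists x => //; rewrite !inE /= xT e ?eqxx // Ti.
by case=> x /[!inE] /andP[xT /eqP e] ->; rewrite r_inv // e in_imfset.
Qed.

Lemma transport_mem c x : c \in cor T -> x \in vars T ->
  (r x \in FV (phi c)) = (x \in FV c).
Proof.
move=> cT xT; rewrite phi_FV //; apply/imfsetP/idP => /= [[y yc /r_inj e]|xc].
  by rewrite e // (FV_vars cT).
by exists x.
Qed.

Lemma transport_graph : is_graph T'.
Proof.
case: Tg => T0 Td Ti Tii; split.
- have /fset0Pn[c cT] := T0; apply/fset0Pn; exists (phi c).
  by rewrite phi_cor in_imfset.
- move=> c' d'; rewrite phi_cor => /imfsetP[c /= cT ->] /imfsetP[d /= dT ->] cd.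
  have {}cd : c != d by apply: contra cd => /eqP ->.
  apply/fdisjointP => y; rewrite phi_FV // => /imfsetP[x /= xc ->].
  rewrite transport_mem //; last exact: FV_vars xc.
  by move/fdisjointP: (Td _ _ cT dT cd); apply.
- move=> y; rewrite transport_vars => /imfsetP[x /= xT ->].
  by rewrite r_inv // in_imfset //= Ti.
- move=> y; rewrite transport_vars => /imfsetP[x /= xT ->].
  by rewrite r_inv // r_inv ?Ti // Tii.
Qed.

Lemma transport_adj : {in cor T &, forall c d, adj T' (phi c) (phi d) = adj T c d}.
Proof.
case: (Tg) => T0 Td Ti Tii.
move=> c d cT dT; rewrite /adj phi_cor cT dT !in_imfset //=.
apply/existsP/existsP => -[[/= x xc]] /andP[].
  move: (xc); rewrite {1}phi_FV // => /imfsetP[y /= yc xE].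
  have yT := FV_vars cT yc; subst x.
  rewrite r_inv // transport_mem // ?Ti // => yd ne.
  exists [` yc]; rewrite /= yd /=; apply: contra ne => /eqP ->; exact: eqxx.
move=> xd ne; have xT := FV_vars cT xc.
have rxc : r x \in FV (phi c) by rewrite transport_mem.
exists [` rxc]; rewrite /= r_inv // transport_mem ?Ti // xd /=.
by apply: contra ne => /eqP /r_inj ->; rewrite ?Ti.
Qed.

Lemma transport_etree : is_etree T -> is_etree T'.
Proof.
case: (Tg) => T0 Td Ti Tii.
case=> _ [Tc Tl Tm Ty]; split; first exact: transport_graph.
split.
- move=> c' d'; rewrite phi_cor => /imfsetP[c /= cT ->] /imfsetP[d /= dT ->].
  have [p pp ->] := Tc _ _ cT dT; exists (map phi p); last by rewrite last_map.
  elim: p c cT pp => //= e p IHp c cT /andP[ce ep].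
  have eT : e \in cor T by case/and3P: ce.
  by rewrite transport_adj // ce IHp.
- move=> c'; rewrite phi_cor => /imfsetP[c /= cT ->] y.
  rewrite {1}phi_FV // => /imfsetP[x /= xc ->].
  have xT := FV_vars cT xc; rewrite r_inv // transport_mem ?Ti // => xc'.
  by rewrite (Tl c).
- move=> c' d'; rewrite phi_cor => /imfsetP[c /= cT ->] /imfsetP[d /= dT ->].
  move=> x' y' cd; have {}cd : c != d by apply: contra cd => /eqP ->.
  rewrite {1 2}phi_FV // => /imfsetP[x /= xc ->] /imfsetP[y /= yc ->].
  have xT := FV_vars cT xc; have yT := FV_vars cT yc.
  rewrite !r_inv // !transport_mem ?Ti // => xd yd.
  by rewrite (Tm _ _ cT dT x y).
- move=> s' s'3 us'; apply/negP => cs'.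
  have s'T : {subset s' <= cor T'}.
    move=> e es'; have := next_cycle cs' es'; by case/and3P.
  have [s sT s'E] : exists2 s, {subset s <= cor T} & s' = map phi s.
    elim: {s'3 us' cs'} s' s'T => [|e s' IHs'] sT; first by exists [::].
    have [|s sT' ->] := IHs'.
      by move=> x xs'; apply: sT; rewrite inE xs' orbT.
    have := sT e (mem_head _ _); rewrite phi_cor => /imfsetP[d /= dT ->].
    by exists (d :: s) => // x /[!inE] /predU1P[->|/sT'].
  have cs : cycle (adj T) s.
    case: s s'E sT {us' s'T s'3} cs' => //= c s -> sT.
    rewrite /= -map_rcons => cs'.
    have: {subset rcons s c <= cor T}.
      by move=> x; rewrite mem_rcons => /sT.
    have cT : c \in cor T by apply: sT; rewrite inE eqxx.
    move: cs'; move: (rcons s c) => t; clear sT s; elim: t c cT => //= e t IHt c cT.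
    case/andP=> ce et stT.
    have eT : e \in cor T by apply: stT; rewrite inE eqxx.
    rewrite transport_adj // in ce; rewrite ce IHt // => x xt.
    by apply: stT; rewrite inE xt orbT.
  move: s'3 us'; rewrite s'E size_map => s3 /map_uniq us.
  by have := Ty s s3 us; rewrite cs.
Qed.

Hypothesis phi_ord : {in cor T, forall c, is_ord (phi c) = is_ord c}.

Lemma transport_utree : is_utree T -> is_utree T'.
Proof.
case=> Te Tk; split; first exact: transport_etree.
case: Tk => [To|[c cT [nc ci]]]; [left|right].
  by move=> c'; rewrite phi_cor => /imfsetP[c /= cT ->]; rewrite phi_ord // To.
have cT' : c \in cor T by rewrite cT inE.
exists (phi c); first by rewrite phi_cor cT imfset_fset1.
rewrite phi_ord // nc; split=> // y; rewrite phi_FV // => /imfsetP[x /= xc ->].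
by rewrite r_inv ?ci //; apply: FV_vars xc.
Qed.

End Transport.

Section Renaming.

Variable V : choiceType.
Implicit Types (X Y : {fset V}) (x : V) (r : V -> V).

Lemma bij_of_renaming r X : {in X &, injective r} ->
  exists s : bij (r @` X) X, forall v, r (val (s v)) = val v.
Proof.
move=> rI.
have ex (v : r @` X) : exists u : X, r (val u) = val v.
  by case: v => v /= /imfsetP[u /= uX ->]; exists [` uX].
pose f v := projT1 (cid (ex v)).
have fE v : r (val (f v)) = val v by apply: projT2 (cid (ex v)).
have gP (u : X) : r (val u) \in r @` X by rewrite in_imfset //= (fsvalP u).
pose g (u : X) : r @` X := [` gP u].
have fK : cancel f g by move=> v; apply: val_inj; rewrite /= fE.
have gK : cancel g f.
  by move=> u; apply/val_inj/rI; rewrite ?fsvalP // fE.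
by exists (Bij fK gK).
Qed.

Lemma bij_renaming_dom r X X' (s : bij X' X) :
  (forall v, r (val (s v)) = val v) -> X' = r @` X.
Proof.
move=> sE; apply/fsetP => y; apply/idP/imfsetP => /= [yX'|[x xX ->]].
  by exists (val (s [` yX'])); rewrite ?fsvalP // sE.
by have := sE (bij_inv s [` xX]); rewrite bij_invK /= => ->; apply: valP.
Qed.

Lemma bij_renaming_inj r X X' (s : bij X' X) :
  (forall v, r (val (s v)) = val v) -> {in X &, injective r}.
Proof.
move=> sE x y xX yX rxy.
have e : bij_inv s [` xX] = bij_inv s [` yX].
  by apply: val_inj; rewrite -!sE !bij_invK.
have /(congr1 val) := congr1 (bij_fun s) e.
by rewrite !bij_invK.
Qed.

(* Every bijection between finite subsets of V extends to an injection of V. *)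
Lemma bij_extend X' X (k : bij X' X) :
  exists2 r, injective r & forall v, r (val (k v)) = val v.
Proof.
pose k1 x := if insub x is Some u then val (bij_inv k u) else x.
have k1E (u : X) : k1 (val u) = val (bij_inv k u) by rewrite /k1 valK.
have k1X x : x \in X -> k1 x \in X'.
  by move=> xX; rewrite (k1E [` xX]) fsvalP.
have k1I : {in X &, injective k1}.
  move=> x y xX yX; rewrite (k1E [` xX]) (k1E [` yX]) => /val_inj.
  by move=> /(can_inj (bij_invK k)) /(congr1 val).
have cXX' : #|` X| = #|` X'|.
  rewrite !cardfE; apply: (bij_eq_card (f := bij_inv k)).
  by exists (bij_fun k); [apply: bij_invK|apply: bijK].
pose A := X' `\` X; pose B := X `\` X'.
have cAB : #|` A| = #|` B|.
  apply: (@addnI #|` X `&` X'|).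
  rewrite [in LHS]fsetIC; move: (cardfsID X X') (cardfsID X' X); rewrite cXX'.
  by move=> -> <-.
pose g x := nth x (enum_fset B) (index x (enum_fset A)).
have gB x : x \in A -> g x \in B.
  by move=> xA; rewrite -[_ \in B]/(_ \in enum_fset B) mem_nth // -cAB index_mem.
have gI : {in A &, injective g}.
  move=> x y xA yA; rewrite /g (set_nth_default x y) -?cAB ?index_mem // => /eqP.
  rewrite nth_uniq -?cAB ?index_mem // => /eqP.
  by move/(congr1 (nth x (enum_fset A))); rewrite !nth_index.
pose r x := if x \in X then k1 x else if x \in A then g x else x.
exists r; last by move=> v; rewrite /r (fsvalP (k v)) k1E bijK.
have rE x : [\/ x \in X /\ r x \in X', x \in A /\ r x \in B
             | x \notin X `|` X' /\ r x = x].
  rewrite /r; have [xX|xX] := boolP (x \in X).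
    by constructor 1; rewrite k1X.
  have [xA|xA] := boolP (x \in A); first by constructor 2; rewrite gB.
  have xX' : x \notin X' by apply: contra xA => xX'; rewrite in_fsetD xX xX'.
  by constructor 3; rewrite in_fsetU negb_or xX xX'.
move=> x y rxy.
case: (rE x) (rE y) => [[xX rx]|[xA rx]|[xn rx]] [[yX ry]|[yA ry]|[yn ry]].
- by move: rxy; rewrite /r xX yX => /k1I; apply.
- by move: ry; rewrite -rxy inE rx.
- by move: yn; rewrite -ry -rxy inE rx orbT.
- by move: rx; rewrite rxy inE ry.
- move: rxy; rewrite /r xA yA; have := xA; have := yA.
  rewrite !in_fsetD => /andP[/negPf-> _] /andP[/negPf-> _]; exact: gI.
- by move: yn; rewrite -ry -rxy inE; move: rx; rewrite inE => /andP[_ ->].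
- by move: xn; rewrite -rx rxy inE ry orbT.
- by move: xn; rewrite -rx rxy inE; move: ry; rewrite inE => /andP[_ ->].
- by rewrite -rx rxy ry.
Qed.

Variable C : species V.
Implicit Types (c d : corolla C) (T : graph C).

Lemma ren_cor_FV r c c' : ren_cor r c c' -> FV c' = r @` FV c.
Proof.
by case: c c' => [X f|X h] [X' f'|X' h'] //= [s sE _]; apply: bij_renaming_dom sE.
Qed.

Lemma ren_cor_ord r c c' : ren_cor r c c' -> is_ord c' = is_ord c.
Proof. by case: c c' => [X f|X h] [X' f'|X' h']. Qed.

Lemma ren_cor_ex r c : {in FV c &, injective r} -> exists c', ren_cor r c c'.
Proof.
case: c => [X f|X h] /= rI.
  by have [s sE] := bij_of_renaming rI; exists (Ord (f ^^ s)), s.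
have h' : #|` r @` X| == 2 by rewrite card_in_imfset.
by exists (Spec h').
Qed.

Lemma ren_cor_inj r c : forall c1 c2, ren_cor r c c1 -> ren_cor r c c2 -> c1 = c2.
Proof.
case: c => [X f|X h] [X1 f1|X1 h1] [X2 f2|X2 h2] //=.
  move=> [s1 s1E ->] [s2 s2E ->].
  have e := bij_renaming_dom s1E; rewrite -(bij_renaming_dom s2E) in e.
  subst X2; congr Ord; congr (_ ^^ _); apply: bijP => v; apply: val_inj.
  by apply: (bij_renaming_inj s1E); rewrite ?fsvalP // s1E s2E.
by move=> e1 e2; subst X1 X2; congr Spec; apply: bool_irrelevance.
Qed.

Lemma eq_ren_cor r r' c c' : {in FV c, r =1 r'} -> ren_cor r c c' -> ren_cor r' c c'.
Proof.
case: c c' => [X f|X h] [X' f'|X' h'] //= rr'; last first.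
  by move->; apply: eq_in_imfset.
by case=> s sE ->; exists s => // v; rewrite -rr' ?fsvalP ?sE.
Qed.

Lemma ren_cor_id r c : {in FV c, r =1 id} -> ren_cor r c c.
Proof.
case: c => [X f|X h] /= rid.
  by exists (bij_id X); rewrite ?sp_map_id // => v; rewrite rid // (fsvalP v).
by apply/fsetP => x; apply/idP/imfsetP => /= [xX|[y yX ->]];
  [exists x; rewrite ?rid|rewrite rid].
Qed.

Lemma ren_cor_comp r r' c c' c'' :
  ren_cor r c c' -> ren_cor r' c' c'' -> ren_cor (r' \o r) c c''.
Proof.
case: c c' c'' => [X f|X h] [X' f'|X' h'] [X'' f''|X'' h''] //=.
  move=> [s sE ->] [t tE ->]; exists (bij_comp s t) => [v|].
    by rewrite /= sE tE.
  by rewrite sp_map_comp.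
by move=> -> ->; rewrite -imfset_comp.
Qed.

Definition bij_sym X Y (s : bij X Y) : bij Y X := Bij (bij_invK s) (bijK s).

Lemma sp_mapK X Y (s : bij X Y) (f : C Y) : f ^^ s ^^ bij_sym s = f.
Proof.
rewrite -sp_map_comp -[RHS]sp_map_id; congr (_ ^^ _); apply: bijP => v /=.
exact: bij_invK.
Qed.

Lemma ren_cor_sym r r' c c' :
  {in FV c, cancel r r'} -> ren_cor r c c' -> ren_cor r' c' c.
Proof.
case: c c' => [X f|X h] [X' f'|X' h'] //= rK.
  case=> s sE ->; exists (bij_sym s); rewrite ?sp_mapK // => v /=.
  by rewrite -sE /= bij_invK rK ?(fsvalP v).
move=> ->; rewrite -imfset_comp; apply/fsetP => x.
by apply/idP/imfsetP => /= [xX|[y yX ->]]; [exists x; rewrite ?rK|rewrite rK].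
Qed.

Lemma renaming_fun r T T' : renaming r T T' ->
  exists2 phi, cor T' = phi @` cor T & {in cor T, forall c, ren_cor r c (phi c)}.
Proof.
case=> rI rC rT.
have ex c : exists c', c \in cor T -> ren_cor r c c'.
  have [cT|_] := boolP (c \in cor T); last by exists c.
  have [|c' cc'] := @ren_cor_ex r c; last by exists c'.
  by move=> x y xc yc; apply: rI; apply: FV_vars; eassumption.
have [phi phiP] := choice ex; exists phi => //.
apply/fsetP => c'; apply/idP/imfsetP => /= [/rC[c cT cc']|[c cT ->]].
  by exists c => //; apply: ren_cor_inj cc' _; apply: phiP.
by apply/rC; exists c => //; apply: phiP.
Qed.

Lemma renaming_vars r T T' : renaming r T T' -> vars T' = r @` vars T.
Proof.
move=> rT; have [phi phiC phiP] := renaming_fun rT.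
by apply: (transport_vars phiC) => c cT; apply: ren_cor_FV (phiP c cT).
Qed.

Lemma renaming_free r T T' :
  is_graph T -> renaming r T T' -> free T' = r @` free T.
Proof.
move=> Tg rT; have [phi phiC phiP] := renaming_fun rT.
case: rT => rI _ ri; apply: (transport_free phiC) => // c cT.
exact: ren_cor_FV (phiP c cT).
Qed.

Lemma renaming_etree r T T' : renaming r T T' -> is_etree T -> is_etree T'.
Proof.
move=> rT Te; have [phi phiC phiP] := renaming_fun rT.
case: rT => rI _ ri; have Tg : is_graph T by case: Te.
by apply: (transport_etree phiC _ rI ri) => // c cT; apply: ren_cor_FV (phiP c cT).
Qed.

Lemma renaming_utree r T T' : renaming r T T' -> is_utree T -> is_utree T'.
Proof.
move=> rT Te; have [phi phiC phiP] := renaming_fun rT.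
case: rT => rI _ ri; have Tg : is_graph T by case: Te => [[]].
apply: (transport_utree phiC _ rI ri) => // c cT.
  exact: ren_cor_FV (phiP c cT).
exact: ren_cor_ord (phiP c cT).
Qed.

Lemma renaming_id r T : {in vars T, r =1 id} -> is_graph T -> renaming r T T.
Proof.
move=> rid [_ _ Ti _]; split.
- by move=> x y xT yT; rewrite !rid.
- have rc c : c \in cor T -> ren_cor r c c.
    by move=> cT; apply: ren_cor_id => x xc; rewrite rid //; apply: FV_vars xc.
  move=> c'; split=> [cT|[c cT cc']]; first by exists c' => //; apply: rc.
  by rewrite -(ren_cor_inj (rc c cT) cc').
- by move=> x xT; rewrite !rid // Ti.
Qed.

Lemma eq_renaming r r' T T' : is_graph T ->
  {in vars T, r =1 r'} -> renaming r T T' -> renaming r' T T'.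
Proof.
move=> [_ _ Ti _] rr' [rI rC ri].
have rr'c c : c \in cor T -> {in FV c, r =1 r'}.
  by move=> cT x xc; apply: rr'; apply: FV_vars xc.
split.
- by move=> x y xT yT; rewrite -!rr' //; apply: rI.
- move=> c'; rewrite rC; split=> -[c cT cc']; exists c => //.
    exact: eq_ren_cor (rr'c _ cT) cc'.
  by apply: eq_ren_cor cc' => x xc; rewrite (rr'c c).
- by move=> x xT; rewrite -!rr' ?Ti // ri.
Qed.

Lemma renaming_comp r r' T T' T'' : is_graph T ->
  renaming r T T' -> renaming r' T' T'' -> renaming (r' \o r) T T''.
Proof.
move=> [_ _ Ti _] rT [rI' rC' ri']; have vT' := renaming_vars rT.
have rv x : x \in vars T -> r x \in vars T' by move=> xT; rewrite vT' in_imfset.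
case: rT => rI rC ri; split.
- by move=> x y xT yT /= /rI' e; apply: rI => //; apply: e; apply: rv.
- move=> c''; rewrite rC'; split=> [[c' /rC[c cT cc'] cc'']|[c cT cc'']].
    by exists c => //; apply: ren_cor_comp cc' cc''.
  have [|c' cc'] := @ren_cor_ex r c.
    by move=> x y xc yc; apply: rI; apply: FV_vars; eassumption.
  have cT' : c' \in cor T' by apply/rC; exists c.
  exists c' => //.
  have [|d'' cd''] := @ren_cor_ex r' c'.
    by move=> x y xc yc; apply: rI'; apply: FV_vars; eassumption.
  by rewrite -(ren_cor_inj (ren_cor_comp cc' cd'') cc'').
- by move=> x xT /=; rewrite ri' ?rv // ri.
Qed.

Lemma renaming_sym r T T' : is_graph T -> renaming r T T' ->
  exists2 r', {in vars T, cancel r r'} & renaming r' T' T.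
Proof.
move=> Tg rT; have vT' := renaming_vars rT.
have [_ _ Ti _] := Tg; case: (rT) => rI rC ri.
have [s sE] := bij_of_renaming rI.
pose r' x := if insub x is Some v then val (s v) else x.
have rK : {in vars T, cancel r r'}.
  move=> x xT; have rx : r x \in r @` vars T by rewrite in_imfset.
  have -> : r' (r x) = val (s [` rx]) by rewrite /r' insubT.
  by apply: rI; rewrite ?sE // fsvalP.
exists r' => //; split.
- move=> x' y'; rewrite vT' => /imfsetP[x /= xT ->] /imfsetP[y /= yT ->].
  by rewrite !rK // => ->.
- have cK c : c \in cor T -> {in FV c, cancel r r'}.
    by move=> cT x xc; rewrite rK //; apply: FV_vars xc.
  move=> c; split=> [cT|[c' /rC[d dT dc'] cc']].
    have [|c' cc'] := @ren_cor_ex r c.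
      by move=> x y xc yc; apply: rI; apply: FV_vars; eassumption.
    exists c'; first by apply/rC; exists c.
    exact: ren_cor_sym (cK c cT) cc'.
  by rewrite -(ren_cor_inj (ren_cor_sym (cK d dT) dc') cc').
- by move=> y; rewrite vT' => /imfsetP[x /= xT ->]; rewrite ri // !rK // Ti.
Qed.

Lemma renaming_ex r T : {in vars T &, injective r} -> is_graph T ->
  exists T', renaming r T T'.
Proof.
move=> rI [_ _ Ti _].
have ex c : exists c', c \in cor T -> ren_cor r c c'.
  have [cT|_] := boolP (c \in cor T); last by exists c.
  have [|c' cc'] := @ren_cor_ex r c; last by exists c'.
  by move=> x y xc yc; apply: rI; apply: FV_vars; eassumption.
have [phi phiP] := choice ex.
have [s sE] := bij_of_renaming rI.
pose i x := if insub x is Some v then r (inv T (val (s v))) else x.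
exists (Graph (phi @` cor T) i); split=> //=.
  move=> c'; split=> [/imfsetP[c /= cT ->]|[c cT cc']].
    by exists c => //; apply: phiP.
  by rewrite (ren_cor_inj cc' (phiP _ cT)) in_imfset.
move=> x xT; have rx : r x \in r @` vars T by rewrite in_imfset.
have -> : i (r x) = r (inv T (val (s [` rx]))) by rewrite /i insubT.
by congr (r (inv T _)); apply: rI; rewrite ?sE // fsvalP.
Qed.

Lemma alpha_refl T : is_graph T -> alpha T T.
Proof. by move=> Tg; exists id => //; apply: renaming_id. Qed.

Lemma free_vars T : {subset free T <= vars T}.
Proof. by move=> x; rewrite !inE /= => /andP[]. Qed.

Lemma alpha_free T T' : is_graph T -> alpha T T' -> free T' = free T.
Proof.
move=> Tg [r rid /(renaming_free Tg) ->].
apply/fsetP => x; apply/imfsetP/idP => /= [[y yT ->]|xT]; first by rewrite rid.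
by exists x; rewrite ?rid.
Qed.

Lemma alpha_etree T T' : alpha T T' -> is_etree T -> is_etree T'.
Proof. by case=> r _; apply: renaming_etree. Qed.

Lemma alpha_utree T T' : alpha T T' -> is_utree T -> is_utree T'.
Proof. by case=> r _; apply: renaming_utree. Qed.

Lemma alpha_sym T T' : is_graph T -> alpha T T' -> alpha T' T.
Proof.
move=> Tg aT; have fT' := alpha_free Tg aT.
case: aT => r rid /(renaming_sym Tg)[r' rK rT']; exists r' => //.
by move=> x; rewrite fT' => xT; rewrite -{1}(rid x xT) rK // free_vars.
Qed.

Lemma alpha_trans T T' T'' : is_graph T -> alpha T T' -> alpha T' T'' -> alpha T T''.
Proof.
move=> Tg aT; have fT' := alpha_free Tg aT.
case: aT => r rid rT [r' rid' rT']; exists (r' \o r); last exact: renaming_comp rT rT'.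
by move=> x xT; rewrite /= rid // rid' // fT'.
Qed.

Lemma alpha_class_eq T T' : is_graph T -> is_graph T' ->
  alpha T T' -> alpha_class T = alpha_class T'.
Proof.
move=> Tg Tg' aT; apply/seteqP; split=> U /= aU.
  exact: alpha_trans (alpha_sym Tg aT) aU.
exact: alpha_trans aT aU.
Qed.

Lemma T_P X (q : T_ C X) : exists T, class_set q T.
Proof.
have [T [Tu _ ->]] := classP q; exists T; apply: alpha_refl.
by case: Tu => [[]].
Qed.

Lemma T_mem X (q : T_ C X) T : class_set q T ->
  [/\ is_utree T, free T = X & class_set q = alpha_class T].
Proof.
have [U [Uu Uf ->]] := classP q => /= aUT.
have Ug : is_graph U by case: Uu => [[]].
have Tu := alpha_utree aUT Uu; split=> //; first by rewrite (alpha_free Ug aUT).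
by apply: alpha_class_eq aUT => //; case: Tu => [[]].
Qed.

Lemma renaming_class X' X (k : bij X' X) (q : T_ C X) :
  exists T', [/\ is_utree T', free T' = X' &
    [set U | exists2 T, class_set q T &
       exists2 r, forall v, r (val (k v)) = val v & renaming r T U]%classic
    = alpha_class T'].
Proof.
have [T qT] := T_P q; have [Tu fT qE] := T_mem qT.
have Tg : is_graph T by case: Tu => [[]].
have [r0 r0I r0E] := bij_extend k.
have [T' rT'] := renaming_ex (T := T) (in2W r0I) Tg.
have Tu' := renaming_utree rT' Tu.
have Tg' : is_graph T' by case: Tu' => [[]].
have fT' : free T' = X'.
  by rewrite (renaming_free Tg rT') fT -(bij_renaming_dom r0E).
exists T'; split=> //; apply/seteqP; split=> U /=.
  case=> T1; rewrite qE => aT [r1 r1E rU].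
  have fT1 := alpha_free Tg aT; rewrite fT in fT1.
  case: aT => r2 r2id rT1.
  have [r3 rK rT] := renaming_sym Tg rT'.
  exists (r1 \o (r2 \o r3)); last first.
    apply: renaming_comp rU => //; exact: renaming_comp rT rT1.
  move=> x; rewrite fT' => xX'; pose v := [` xX'].
  have kX : val (k v) \in free T by rewrite fT fsvalP.
  rewrite -[x]/(val v) -{1}(r0E v) /= rK ?free_vars //.
  by rewrite r2id // r1E.
case=> r rid rU; exists T => //; exists (r \o r0); last exact: renaming_comp rT' rU.
by move=> v; rewrite /= r0E rid // fT' (fsvalP v).
Qed.

End Renaming.

Section Monad.

Variable V : choiceType.
Implicit Types (X Y : {fset V}) (C D : species V).

(* [T]^k : each free variable x of T is renamed to k^-1(x), and the other
   variables are renamed arbitrarily. *)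
Definition T_map C X' X (k : bij X' X) (q : T_ C X) : T_ C X' :=
  Class (renaming_class k q).

Lemma T_map_id C X (q : T_ C X) : T_map (bij_id X) q = q.
Proof.
apply: class_inj; apply/seteqP; split=> U /=.
  case=> T qT [r rE rU]; have [Tu fT ->] := T_mem qT; exists r => // x.
  by rewrite fT => xX; apply: (rE [` xX]).
have [T qT] := T_P q; have [Tu fT qE] := T_mem qT.
move=> qU; exists T => //; move: qU; rewrite qE => -[r rid rU].
by exists r => // v; rewrite rid // fT fsvalP.
Qed.

Lemma T_map_comp C X'' X' X (s : bij X' X) (t : bij X'' X') (q : T_ C X) :
  T_map (bij_comp s t) q = T_map t (T_map s q).
Proof.
apply: class_inj.
have [T qT] := T_P q; have [Tu fT qE] := T_mem qT.
have Tg : is_graph T by case: Tu => [[]].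
have [r1 r1I r1E] := bij_extend s; have [r2 r2I r2E] := bij_extend t.
have [T1 rT1] := renaming_ex (T := T) (in2W r1I) Tg.
have q1 : class_set (T_map s q) T1 by exists T => //; exists r1.
have [T1u fT1 _] := T_mem q1.
have T1g : is_graph T1 by case: T1u => [[]].
have [T2 rT2] := renaming_ex (T := T1) (in2W r2I) T1g.
have q2 : class_set (T_map t (T_map s q)) T2 by exists T1 => //; exists r2.
have [_ _ ->] := T_mem q2.
have q2' : class_set (T_map (bij_comp s t) q) T2.
  exists T => //; exists (r2 \o r1); last exact: renaming_comp rT1 rT2.
  by move=> v; rewrite /= r1E r2E.
by have [_ _ ->] := T_mem q2'.
Qed.

(* The object part of the monad of unrooted trees. *)
Definition TT C : species V :=
  @Species V (T_ C) (@T_map C) (@T_map_id C) (@T_map_comp C).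

Definition cor_map C D (a : nat_trans C D) (c : corolla C) : corolla D :=
  match c with
  | @Ord _ _ X f => Ord (a X f)
  | @Spec _ _ X h => Spec h
  end.

Definition graph_map C D (a : nat_trans C D) (T : graph C) : graph D :=
  Graph (cor_map a @` cor T) (inv T).

Lemma cor_map_FV C D (a : nat_trans C D) c : FV (cor_map a c) = FV c.
Proof. by case: c. Qed.

Lemma graph_map_vars C D (a : nat_trans C D) T : vars (graph_map a T) = vars T.
Proof.
rewrite (@transport_vars _ _ _ T (graph_map a T) (cor_map a) id) ?imfset_id //.
by move=> c _; rewrite imfset_id cor_map_FV.
Qed.

Lemma graph_map_free C D (a : nat_trans C D) T : free (graph_map a T) = free T.
Proof. by apply/fsetP => x; rewrite !inE /= graph_map_vars. Qed.

Lemma graph_map_utree C D (a : nat_trans C D) T :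
  is_utree T -> is_utree (graph_map a T).
Proof.
move=> Tu; apply: (@transport_utree _ _ _ T _ (cor_map a) id) => //.
- by move=> c _; rewrite imfset_id cor_map_FV.
- by case: Tu => [[]].
- by move=> c _; case: c.
Qed.

Lemma graph_map_renaming C D (a : nat_trans C D) r T U :
  renaming r T U -> renaming r (graph_map a T) (graph_map a U).
Proof.
move=> rU; have [rI rC ri] := rU.
have mC c c' : ren_cor r c c' -> ren_cor r (cor_map a c) (cor_map a c').
  case: c c' => [X f|X h] [X' f'|X' h'] //= [s sE ->].
  by exists s => //; rewrite nt_nat.
split; rewrite ?graph_map_vars // => c'; split.
  case/imfsetP => /= d /rC[c cT cd] ->; exists (cor_map a c); last exact: mC.
  by rewrite in_imfset.
case=> _ /imfsetP[c /= cT ->] cc'.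
have [|d cd] := @ren_cor_ex _ _ r c.
  by move=> x y xc yc; apply: rI; apply: FV_vars; eassumption.
rewrite -(ren_cor_inj (mC _ _ cd) cc') in_imfset //=.
by apply/rC; exists c.
Qed.

Lemma graph_map_class C D (a : nat_trans C D) X (q : T_ C X) :
  exists T', [/\ is_utree T', free T' = X &
    [set U | exists2 T, class_set q T & alpha (graph_map a T) U]%classic
    = alpha_class T'].
Proof.
have [T qT] := T_P q; have [Tu fT qE] := T_mem qT.
have Tg : is_graph T by case: Tu => [[]].
have aTu := graph_map_utree a Tu.
have aTg : is_graph (graph_map a T) by case: aTu => [[]].
exists (graph_map a T); split=> //; first by rewrite graph_map_free.
apply/seteqP; split=> U /= => [[T1]|aU]; last by exists T.
rewrite qE => -[r rid rT1] aU; apply: alpha_trans aU => //.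
by exists r; [rewrite graph_map_free|apply: graph_map_renaming].
Qed.

Definition T_hom C D (a : nat_trans C D) X (q : TT C X) : TT D X :=
  Class (graph_map_class a q).

Lemma eta_class C X (f : C X) : exists T',
  [/\ is_utree T', free T' = X &
   alpha_class (Graph [fset Ord f] id) = alpha_class T'].
Proof.
have vE : vars (Graph [fset Ord f] id) = X.
  apply/fsetP => x; apply/varsP/idP => /= [[c]|xX].
    by rewrite inE => /eqP ->.
  by exists (Ord f); rewrite ?inE.
exists (Graph [fset Ord f] id); split=> //; last first.
  by apply/fsetP => x; rewrite !inE /= vE eqxx andbT.
split; last by left=> c /=; rewrite inE => /eqP ->.
split; split=> //=.
- by apply/fset0Pn; exists (Ord f); rewrite inE.
- by move=> c d; move=> /fset1P -> /fset1P ->; rewrite eqxx.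
- by move=> c d; move=> /fset1P -> /fset1P ->; exists [::].
- by move=> c d; move=> /fset1P -> /fset1P ->; rewrite eqxx.
- case=> // c [|d s] // _ _; apply/negP => /= /andP[/and3P[_ _]].
  by case/existsP => x; rewrite eqxx andbF.
Qed.

(* The unit of the monad. *)
Definition eta C X (f : C X) : TT C X := Class (eta_class f).

(* Contraction of an edge which joins a special corolla to another corolla. *)
Inductive step C (T T' : graph C) : Prop :=
| step_ord X (f : C X) x y z (h : #|` [fset y; z]| == 2)
    (t : bij ((X `\ x) `|` [fset z]) X) of
    Ord f \in cor T & Spec h \in cor T &
    x \in X & inv T x = y & renames t &
    cor T' = Ord (f ^^ t) |` (cor T `\ Ord f `\ Spec h) &
    {in vars T', inv T' =1 inv T}
| step_spec x y u v (hxy : #|` [fset x; y]| == 2) (huv : #|` [fset u; v]| == 2)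
    (hxv : #|` [fset x; v]| == 2) of
    Spec hxy \in cor T & Spec huv \in cor T & [fset x; y] != [fset u; v] &
    inv T y = u &
    cor T' = Spec hxv |` (cor T `\ Spec hxy `\ Spec huv) &
    {in vars T', inv T' =1 inv T}.

(* The reflexive transitive closure of the one-step reduction on classes. *)
Inductive reduces C X : eT C X -> eT C X -> Prop :=
| reduces_refl q : reduces q q
| reduces_step q q' q'' T T' of
    class_set q T & class_set q' T' & step T T' & reduces q' q'' : reduces q q''.

(* The graph of nf : eT(X) -> T(X). *)
Definition is_nf C X (u : eT C X) (s : T_ C X) : Prop :=
  exists2 w : eT C X, reduces u w & class_set w = class_set s.

Definition flattens C (T : graph (TT C)) (U : graph C) : Prop :=
  (exists X (h : #|` X| == 2),
     [/\ cor T = [fset Spec h], cor U = [fset Spec h] & {in X, inv U =1 inv T}]) \/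
  (is_ordinary T /\ exists R : corolla (TT C) -> graph C,
     [/\ forall Y (q : TT C Y), Ord q \in cor T -> class_set q (R (Ord q)),
         {in cor T &, forall c d, c != d -> [disjoint vars (R c) & vars (R d)]},
         cor U = \bigcup_(c <- cor T) cor (R c) &
         {in cor T, forall c x, x \in vars (R c) ->
            inv U x = if x \in free (R c) then inv T x else inv (R c) x}]).

(* The graph of flat : TT(X) -> eT(X). *)
Definition is_flat C X (t : TT (TT C) X) (u : eT C X) : Prop :=
  exists T U, [/\ class_set t T, class_set u U & flattens T U].

(* The graph of mu = nf o flat. *)
Definition is_mu C X (t : TT (TT C) X) (s : TT C X) : Prop :=
  exists2 u : eT C X, is_flat t u & is_nf u s.

Record M_algebra C := MAlgebra {
  ma_delta : nat_trans (TT C) C;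
  ma_mu : forall X (t : TT (TT C) X) (s : TT C X), is_mu t s ->
    ma_delta X (T_hom ma_delta t) = ma_delta X s;
  ma_eta : forall X (f : C X), ma_delta X (eta f) = f }.

End Monad.

(* Main.v *)
From HB Require Import structures.
From mathcomp Require Import all_boot finmap.
From mathcomp Require Import boolp classical_sets cardinality.
Require Import Defs.

(* From a cyclic operad to an algebra: read a special corolla (x,y) as the unit
   id_{x,y} and contract the edges of a tree one by one, composing the
   parameters of their ends.  By (A1) and (CO), contractions of two distinct
   edges commute, so that the result does not depend on the order.  Then (EQ)
   gives naturality, (U1) and (U3) say that the reductions to normal form are
   contractions, and flattening amounts to contracting the inner edges first.

   Conversely, evaluate by delta the trees with one special corolla and with
   two corollas, after renaming x and y to fresh variables.  By compatibility
   with mu, the two sides of (A1) are both the value of the tree with the three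
   corollas f, g, h, and (U1) is the reduction of f and a special corolla. *)

Set Implicit Arguments.
Unset Strict Implicit.
Unset Printing Implicit Defensive.

Local Open Scope fset_scope.

(** * Elements packed with their supports, and their renaming *)

Section Elements.

Variables (V : choiceType) (C : species V).
Implicit Types (X Y : {fset V}) (x y : V) (r : V -> V).

(** The index sets of the two sides of (A1), (CO) or (U1) are equal but not convertible. Elements
    are therefore packed with their supports: [=~] becomes plain equality in [elt], and partial
    operations become total with junk values. The value of a tree is a relation [ev] on a finite set
    of packed elements and one fixed map on V. Contracting an edge only forgets two variables, so no
    graph has to be rebuilt. Uniqueness of the value rests on [wf], which says less than being a
    tree and is stable under contraction. Existence needs connectedness and absence of cycles, both
    restated through predicates, since paths would have to be rerouted after each contraction. In
    the converse the obstacle is that [f] and [g] can be composed when [y] occurs in [f], or [x] in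
    [g], or [x = y], whereas the corollas of a graph have disjoint variables. This is where fresh
    variables, and so the infinity of V, enter. (A1) and (U1) are shown for disjoint supports and
    then transported by [pcomp_rn]. *)

Definition elt := {X : {fset V} & C X}.

HB.instance Definition _ := gen_eqMixin elt.
HB.instance Definition _ := gen_choiceMixin elt.

Definition elm X (f : C X) : elt := Tagged (sp_obj C) f.
Definition supp (e : elt) : {fset V} := tag e.
Definition ord (e : elt) : corolla C := Ord (tagged e).

Lemma elm_inj X : injective (@elm X).
Proof. exact: eq_from_Tagged. Qed.

Definition elt_cast (e : elt) X (h : supp e = X) : C X :=
  let: erefl := h in tagged e.

Lemma taggedE e : elm (tagged e) = e.
Proof. by case: e. Qed.

Lemma elt_castE e X (h : supp e = X) : elm (elt_cast h) = e.
Proof. by case: X / h; case: e. Qed.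

(* Junk value [e] when [r] is not injective on [supp e]. *)
Definition rn r (e : elt) : elt :=
  if pselect {in supp e &, injective r} is left rI
  then elm (tagged e ^^ projT1 (cid (bij_of_renaming rI))) else e.

(** The action of C is contravariant while renamings push variables forward, so [s] inverts [r]. It
    is determined by [r], hence the choice made inside [rn] does not matter. *)
Lemma rnE r X X' (f : C X) (s : bij X' X) :
  (forall v, r (val (s v)) = val v) -> rn r (elm f) = elm (f ^^ s).
Proof.
move=> sE; rewrite /rn; case: pselect => [rI|[]]; last exact: bij_renaming_inj sE.
case: cid => s' s'E /=; have e := bij_renaming_dom sE; subst X'.
congr (elm (_ ^^ _)); apply: bijP => v; apply: val_inj.
by apply: rI; rewrite ?fsvalP // sE s'E.
Qed.

Lemma ren_cor_rn r X X' (f : C X) (f' : C X') :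
  ren_cor r (Ord f) (Ord f') -> elm f' = rn r (elm f).
Proof. by case=> s sE ->; rewrite (rnE f sE). Qed.

Lemma rnP r e : {in supp e &, injective r} -> ren_cor r (ord e) (ord (rn r e)).
Proof.
case: e => X f rI; have [s sE] := bij_of_renaming rI.
by rewrite (rnE f sE); exists s.
Qed.

Lemma supp_rn r e : {in supp e &, injective r} -> supp (rn r e) = r @` supp e.
Proof. by move=> /rnP /ren_cor_FV. Qed.

Lemma eq_rn r r' e : {in supp e, r =1 r'} -> rn r e = rn r' e.
Proof.
case: e => X f rr'; have [rI|nI] := pselect {in X &, injective r}.
  have [s sE] := bij_of_renaming rI; rewrite (rnE f sE) (@rnE r' _ _ f s) // => v.
  by rewrite -rr' ?fsvalP // sE.
rewrite /rn; case: pselect => // _; case: pselect => // rI; case: nI => x y xX yX.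
by rewrite !rr' //; apply: rI.
Qed.

Lemma rn_id r e : {in supp e, r =1 id} -> rn r e = e.
Proof.
case: e => X f rid; rewrite (@rnE r _ _ f (bij_id X)) ?sp_map_id //.
by move=> v; rewrite rid // (fsvalP v).
Qed.

Lemma rn_comp r r' e : {in supp e &, injective r} ->
  {in supp e &, injective (r' \o r)} -> rn r' (rn r e) = rn (r' \o r) e.
Proof.
move=> rI rI'; have r'I : {in supp (rn r e) &, injective r'}.
  rewrite supp_rn // => _ _ /imfsetP[x /= xe ->] /imfsetP[y /= ye ->] e'.
  by congr r; apply: rI'.
by have /ren_cor_rn := ren_cor_comp (rnP rI) (rnP r'I); rewrite !taggedE.
Qed.

End Elements.

Lemma bij_onto (V : choiceType) (r : V -> V) (Z Z' : {fset V}) :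
  {in Z &, injective r} -> Z' = r @` Z ->
  exists s : bij Z' Z, forall v, r (val (s v)) = val v.
Proof. by move=> rI ->; apply: bij_of_renaming. Qed.

(** * The operad axioms on packed elements *)

Section OperadElements.

Variables (V : choiceType) (C : species V) (O : cyclic_operad C).
Implicit Types (c d e : elt C) (x y z u : V) (r : V -> V).

Definition joinable c x y d : bool :=
  [&& x \in supp c, y \in supp d & fdisjoint (supp c `\ x) (supp d `\ y)].

(* Junk value [c] when [joinable c x y d] fails. *)
Definition ecomp c x y d : elt C :=
  match @idP (x \in supp c), @idP (y \in supp d),
        @idP (fdisjoint (supp c `\ x) (supp d `\ y)) with
  | ReflectT xc, ReflectT yd, ReflectT cd =>
      elm (co_comp O xc yd cd (tagged c) (tagged d))
  | _, _, _ => c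
  end.

Lemma ecompE X Y x y (f : C X) (g : C Y) (xX : x \in X) (yY : y \in Y)
    (dXY : [disjoint X `\ x & Y `\ y]) :
  ecomp (elm f) x y (elm g) = elm (co_comp O xX yY dXY f g).
Proof.
rewrite /ecomp; case: {-}_ / idP => [xX'|/(_ xX)//].
case: {-}_ / idP => [yY'|/(_ yY)//]; case: {-}_ / idP => [d'|/(_ dXY)//].
congr (elm (co_comp O _ _ _ _ _)); exact: bool_irrelevance.
Qed.

Lemma supp_ecomp c x y d : joinable c x y d ->
  supp (ecomp c x y d) = (supp c `\ x) `|` (supp d `\ y).
Proof. by case: c d => X f [Y g] /and3P[xX yY dXY]; rewrite (ecompE f g xX yY dXY). Qed.

Lemma ecompC c x y d : joinable c x y d -> ecomp c x y d = ecomp d y x c.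
Proof.
case: c d => X f [Y g] /and3P[xX yY dXY]; have := dXY; rewrite fdisjoint_sym => dYX.
rewrite (ecompE f g xX yY dXY) (ecompE g f yY xX dYX); exact: co_CO.
Qed.

Lemma ecompA c x y d u z e : joinable c x y d -> joinable d u z e ->
  joinable (ecomp c x y d) u z e -> joinable c x y (ecomp d u z e) -> y != u ->
  ecomp (ecomp c x y d) u z e = ecomp c x y (ecomp d u z e).
Proof.
case: c d e => X f [Y g] [Z h].
move=> /and3P[/= xX yY dXY] /and3P[/= uY zZ dYZ].
rewrite (ecompE f g xX yY dXY) (ecompE g h uY zZ dYZ).
move=> /and3P[/= a1 a2 a3] /and3P[/= b1 b2 b3] yu.
rewrite (ecompE _ h a1 a2 a3) (ecompE f _ b1 b2 b3).
rewrite (bool_irrelevance a2 zZ) (bool_irrelevance b1 xX).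
exact: co_A1 dXY a1 a3 dYZ b2 b3 yu.
Qed.

(** (EQ) for a single map, injective on the union of the supports. In this form the two bijections
    and their glueing need not be carried along. *)
Lemma ecomp_rn r c x y d : joinable c x y d ->
  [disjoint supp c & supp d] -> {in supp c `|` supp d &, injective r} ->
  ecomp (rn r c) (r x) (r y) (rn r d) = rn r (ecomp c x y d).
Proof.
case: c d => X f [Y g] /and3P[/= xX yY dXY] dis rI.
have rX : {in X &, injective r}.
  by move=> a b aX bX; apply: rI; rewrite inE ?aX ?bX.
have rY : {in Y &, injective r}.
  by move=> a b aX bX; apply: rI; rewrite inE ?aX ?bX orbT.
have [s1 s1E] := bij_of_renaming rX; have [s2 s2E] := bij_of_renaming rY.
have rx : r x = val (bij_inv s1 [` xX]) by rewrite -s1E bij_invK.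
have ry : r y = val (bij_inv s2 [` yY]) by rewrite -s2E bij_invK.
rewrite (rnE f s1E) (rnE g s2E) (ecompE f g xX yY dXY) rx ry.
have imD (A : {fset V}) a : {in A &, injective r} -> a \in A ->
    (r @` A) `\ r a = r @` (A `\ a).
  move=> rA aA; apply/fsetP => b; rewrite !inE; apply/andP/imfsetP => /=.
    case=> ba /imfsetP[/= b' b'A be]; exists b' => //; rewrite !inE b'A andbT.
    by apply: contra ba => /eqP <-; rewrite be.
  case=> b'; rewrite !inE => /andP[b'a b'A] ->; rewrite in_imfset //; split=> //.
  by apply: contra b'a => /eqP /rA ->.
have e : (r @` X `\ val (bij_inv s1 [` xX])) `|` (r @` Y `\ val (bij_inv s2 [` yY])) =
    r @` ((X `\ x) `|` (Y `\ y)).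
  by rewrite -rx -ry !imD // imfsetU.
have [|s sE] := @bij_onto _ r ((X `\ x) `|` (Y `\ y)) _ _ e.
  by move=> a b; rewrite !inE => A B; apply: rI; rewrite inE;
    [case/orP: A => /andP[_ ->]|case/orP: B => /andP[_ ->]]; rewrite ?orbT.
rewrite (rnE _ sE).
have dd : [disjoint r @` X `\ val (bij_inv s1 [` xX]) &
                    r @` Y `\ val (bij_inv s2 [` yY])].
  rewrite -rx -ry !imD //; apply/fdisjointP => a /imfsetP[/= b bX ->].
  apply/imfsetP => -[/= b' b'Y]; move: bX b'Y; rewrite !inE.
  case/andP=> bx bX /andP[b'y b'Y] /rI; rewrite !inE bX b'Y orbT => /(_ isT isT) e'.
  by move/fdisjointP: dis => /(_ b bX); rewrite e' b'Y.
rewrite (ecompE _ _ (valP (bij_inv s1 [` xX])) (valP (bij_inv s2 [` yY])) dd).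
congr elm.
rewrite (@co_EQ _ _ O X Y _ _ s1 s2 [` xX] [` yY] f g dXY dd s) /=.
  by congr (co_comp O _ _ _ _ _ ^^ s); apply: bool_irrelevance.
(* Applying [r] undoes each of [s], [s1] and [s2], so injectivity of [r] makes them agree, which is
   [glues]. *)
have sI : {in X `|` Y &, forall a b, r a = r b -> a = b} by exact: rI.
split=> v w vw _; apply: sI.
- have := fsvalP (s v); rewrite !inE => /orP[] /andP[_ ->]; rewrite ?orbT //.
- by rewrite inE fsvalP.
- by rewrite sE s1E.
- have := fsvalP (s v); rewrite !inE => /orP[] /andP[_ ->]; rewrite ?orbT //.
- by rewrite inE fsvalP orbT.
- by rewrite sE s2E.
Qed.

End OperadElements.

(** * Evaluation by contraction of edges, and its independence of the order *)

Section Contraction.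

Variables (V : choiceType) (C : species V) (O : cyclic_operad C).
Implicit Types (a b c d e : elt C) (x y z u : V) (i r : V -> V) (A : {fset elt C}).

Local Notation comp := (ecomp O).

Definition edge i A c x d : bool :=
  [&& c \in A, d \in A, c != d, x \in supp c & i x \in supp d].

Definition contract i A c x d : {fset elt C} :=
  comp c x (i x) d |` (A `\ c `\ d).

(** The map [i] stays fixed along a derivation: the two variables of a contracted edge merely cease
    to be [on] the family. The condition in [ev_one] forbids a remaining loop. *)
Inductive ev i : {fset elt C} -> elt C -> Prop :=
| ev_one e : {in supp e, i =1 id} -> ev i [fset e] e
| ev_step A c x d e :
    edge i A c x d -> ev i (contract i A c x d) e -> ev i A e.

Definition on A x : Prop := exists2 c, c \in A & x \in supp c.

(** The part of being a graph that every contraction preserves; loops, parallel edges and cycles are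
    still allowed. *)
Record wf i A : Prop := Wf {
  wf_eq : forall c d x, c \in A -> d \in A -> x \in supp c -> x \in supp d -> c = d;
  wf_on : forall x, on A x -> on A (i x);
  wf_inv : forall x, on A x -> i (i x) = x }.

Lemma edgeP i A c x d :
  reflect [/\ c \in A, d \in A, c != d, x \in supp c & i x \in supp d]
    (edge i A c x d).
Proof. exact: and5P. Qed.

Lemma mem_contract i A c x d a :
  (a \in contract i A c x d) =
  (a == comp c x (i x) d) || [&& a != d, a != c & a \in A].
Proof. by rewrite !inE. Qed.

Section Wf.

Variables (i : V -> V) (A : {fset elt C}).
Hypothesis Awf : wf i A.

Lemma edge_on c x d : edge i A c x d -> on A x.
Proof. by case/edgeP=> cA _ _ xc _; exists c. Qed.

Lemma edge_invK c x d : edge i A c x d -> i (i x) = x.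
Proof. by move/edge_on/(wf_inv Awf). Qed.

Lemma wf_disjoint c d : c \in A -> d \in A -> c != d -> fdisjoint (supp c) (supp d).
Proof.
move=> cA dA cd; apply/fdisjointP => x xc; apply: contra cd => xd.
by rewrite (wf_eq Awf cA dA xc xd).
Qed.

Lemma edge_joinable c x d : edge i A c x d -> joinable c x (i x) d.
Proof.
case/edgeP=> cA dA cd xc xd; rewrite /joinable xc xd /=.
apply/fdisjointP => z; rewrite !inE => /andP[_ zc].
by move/fdisjointP: (wf_disjoint cA dA cd) => /(_ z zc)/negPf->; rewrite andbF.
Qed.

Lemma edge_notin c x d : edge i A c x d -> (x \notin supp d) * (i x \notin supp c).
Proof.
case/edgeP=> cA dA /eqP cd xc xd.
by split; apply/negP => h; apply: cd; [apply: (wf_eq Awf cA dA xc h)|apply: (wf_eq Awf cA dA h xd)].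
Qed.

Lemma supp_edge c x d : edge i A c x d ->
  supp (comp c x (i x) d) = ((supp c `|` supp d) `\ x) `\ i x.
Proof.
move=> E; rewrite supp_ecomp ?edge_joinable //; apply/fsetP => z; rewrite !inE.
have [xd ic] := edge_notin E.
have [->|_] := eqVneq z x; first by rewrite (negPf xd) !andbF.
by have [->|_] := eqVneq z (i x); rewrite //= (negPf ic).
Qed.

Lemma edge_sym c x d : edge i A c x d -> edge i A d (i x) c.
Proof.
move=> E; have := E; case/edgeP=> cA dA cd xc xd.
by apply/edgeP; rewrite (edge_invK E) eq_sym.
Qed.

Lemma contract_sym c x d : edge i A c x d ->
  contract i A d (i x) c = contract i A c x d.
Proof.
move=> E; rewrite /contract (edge_invK E) (ecompC O (edge_joinable E)).
by congr (_ |` _); apply/fsetP => a; rewrite !inE andbCA.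
Qed.

Lemma on_contract c x d z : edge i A c x d ->
  on (contract i A c x d) z <-> [/\ on A z, z != x & z != i x].
Proof.
move=> E; have := E; case/edgeP=> cA dA cd xc xd; split.
  case=> a; rewrite mem_contract => /predU1P[->|/and3P[ad ac aA] za].
    rewrite supp_edge // !inE => /and3P[zi zx /orP[zc|zd]]; split=> //.
      by exists c.
    by exists d.
  split; first by exists a.
    by apply: contra ac => /eqP zx; rewrite (wf_eq Awf aA cA za) // zx.
  by apply: contra ad => /eqP zx; rewrite (wf_eq Awf aA dA za) // zx.
case=> -[a aA za] zx zi; have [ac|ac] := eqVneq a c.
  exists (comp c x (i x) d); first by rewrite mem_contract eqxx.
  by rewrite supp_edge // !inE zi zx -ac za.
have [ad|ad] := eqVneq a d.
  exists (comp c x (i x) d); first by rewrite mem_contract eqxx.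
  by rewrite supp_edge // !inE zi zx -ad za orbT.
by exists a => //; rewrite mem_contract ac ad aA orbT.
Qed.

Lemma wf_contract c x d : edge i A c x d -> wf i (contract i A c x d).
Proof.
move=> E; have := E; case/edgeP=> cA dA cd xc xd; split.
- have aux a z : [&& a != d, a != c & a \in A] -> z \in supp a ->
      z \in supp (comp c x (i x) d) -> False.
    case/and3P=> ad ac aA za; rewrite supp_edge // !inE.
    case/and3P=> _ _ /orP[zc|zd].
      by move/eqP: ac; apply; apply: (wf_eq Awf aA cA za zc).
    by move/eqP: ad; apply; apply: (wf_eq Awf aA dA za zd).
  move=> a b z; rewrite !mem_contract.
  move=> /predU1P[->|aA] /predU1P[->|bA] // za zb.
  + by case: (aux b z).
  + by case: (aux a z).
  by case/and3P: aA => _ _ aA; case/and3P: bA => _ _ bA; apply: (wf_eq Awf aA bA za zb).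
- move=> z /(on_contract _ E)[zA zx zi]; apply/(on_contract _ E).
  split; first exact: wf_on.
    by apply: contra zi => /eqP <-; rewrite (wf_inv Awf).
  apply: contra zx => /eqP e.
  by rewrite -(wf_inv Awf zA) e (edge_invK E).
- by move=> z /(on_contract _ E)[zA _ _]; apply: wf_inv zA.
Qed.

End Wf.

(** This is (A1) at the shared element [d]. The condition [c != e] rules out parallel edges, of
    which one would become a loop when the other is contracted. *)
Lemma contract_adj i A c x d u e : wf i A ->
  edge i A c x d -> edge i A d u e -> c != e ->
  let k := comp c x (i x) d in let k' := comp d u (i u) e in
  [/\ edge i (contract i A c x d) k u e,
      edge i (contract i A d u e) c x k' &
      contract i (contract i A c x d) k u e = contract i (contract i A d u e) c x k'].
Proof.
move=> Awf E E' ce k k'; have Ad := wf_contract Awf E; have Ad' := wf_contract Awf E'.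
have := E; case/edgeP=> cA dA cd xc xd; have := E'; case/edgeP=> _ eA de ud ue.
have [xnd xnc] := edge_notin Awf E; have [une und] := edge_notin Awf E'.
have xu : i x != u.
  apply: contra ce => /eqP e'; apply/eqP; apply: (wf_eq Awf (x := x)) => //.
  by rewrite -(edge_invK Awf E) e'.
have ux : u != x by apply: contra xnd => /eqP <-.
have uk : u \in supp k by rewrite (supp_edge Awf) // !inE eq_sym xu ux ud orbT.
have xk : i x \in supp k'.
  by rewrite (supp_edge Awf) // !inE xu xd /= andbT; apply: contra und => /eqP <-.
(* A member of [A] equal to [k] would contain [u] and so be [d], but [k] has lost [i x]. *)
have nk a : a \in A -> a != k.
  move=> aA; apply/eqP => ak; rewrite -ak in uk.
  have ad := wf_eq Awf aA dA uk ud; move: xd.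
  by rewrite -ad ak (supp_edge Awf) // !inE eqxx.
have nk' a : a \in A -> a != k'.
  move=> aA; apply/eqP => ak; rewrite -ak in xk.
  have ad := wf_eq Awf aA dA xk xd; move: ud.
  by rewrite -ad ak (supp_edge Awf) // !inE eqxx /= andbF.
have F : edge i (contract i A c x d) k u e.
  apply/edgeP; split=> //; rewrite ?mem_contract ?eqxx //.
  - by rewrite (eq_sym e d) de (eq_sym e c) ce eA orbT.
  - by rewrite eq_sym nk.
have F' : edge i (contract i A d u e) c x k'.
  apply/edgeP; split=> //; rewrite ?mem_contract ?eqxx //.
  - by rewrite ce cd cA orbT.
  - exact: nk'.
split=> //; rewrite {1}/contract {2}/contract.
have -> : comp k u (i u) e = comp c x (i x) k'.
  apply: ecompA => //; first exact: (edge_joinable Awf E).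
  - exact: (edge_joinable Awf E').
  - exact: (edge_joinable Ad F).
  - exact: (edge_joinable Ad' F').
congr (_ |` _); apply/fsetP => a; rewrite !inE -/k -/k'.
have [aA|_] := boolP (a \in A).
  rewrite !(negPf (nk _ aA)) !(negPf (nk' _ aA)) /=.
  by case: (a == c); case: (a == d); case: (a == e).
by rewrite !andbF !orbF; case: (a == k); case: (a == k'); rewrite ?andbF.
Qed.

(** With four distinct ends, the same two composites replace them in either order. *)
Lemma contract_far i A c x d c' x' d' : wf i A ->
  edge i A c x d -> edge i A c' x' d' ->
  c != c' -> c != d' -> d != c' -> d != d' ->
  [/\ edge i (contract i A c x d) c' x' d',
      edge i (contract i A c' x' d') c x d &
      contract i (contract i A c x d) c' x' d' =
      contract i (contract i A c' x' d') c x d].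
Proof.
move=> Awf E E' cc' cd' dc' dd'.
have aux c1 x1 d1 c2 x2 d2 : edge i A c1 x1 d1 -> edge i A c2 x2 d2 ->
    c1 != c2 -> c1 != d2 -> d1 != c2 -> d1 != d2 ->
    edge i (contract i A c1 x1 d1) c2 x2 d2 /\
    (c2 != comp c1 x1 (i x1) d1) * (d2 != comp c1 x1 (i x1) d1).
  move=> E1 E2 h1 h2 h3 h4.
  have := E1; case/edgeP=> cA1 dA1 cd1 xc1 xd1.
  have := E2; case/edgeP=> cA2 dA2 cd2 xc2 xd2; split.
    apply/edgeP; rewrite !mem_contract cA2 dA2 !(eq_sym c2) h1 h3.
    by rewrite !(eq_sym d2) h2 h4 !orbT.
  have nin a z : a \in A -> c1 != a -> d1 != a -> z \in supp a ->
      a != comp c1 x1 (i x1) d1.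
    move=> aA ca da za; apply/eqP => ak; move: (za); rewrite ak (supp_edge Awf) // !inE.
    case/and3P=> _ _ /orP[] h.
      by move/eqP: ca; apply; apply: (wf_eq Awf cA1 aA h za).
    by move/eqP: da; apply; apply: (wf_eq Awf dA1 aA h za).
  by split; [apply: (nin c2 x2)|apply: (nin d2 (i x2))].
have [F [n1 n2]] := aux _ _ _ _ _ _ E E' cc' cd' dc' dd'.
have [||||F' [n3 n4]] := aux _ _ _ _ _ _ E' E; rewrite 1?eq_sym //.
split=> //; apply/fsetP => a; rewrite !mem_contract.
have [->|_] := eqVneq a c.
  by rewrite ?eqxx (negPf n3) cc' cd' /= !andbF ?orbF.
have [->|_] := eqVneq a d.
  by rewrite ?eqxx (negPf n4) dc' dd' /= ?andbF ?orbF.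
have [->|_] := eqVneq a c'.
  by rewrite ?eqxx (negPf n1) /= ?andbF ?orbF.
have [->|_] := eqVneq a d'.
  by rewrite ?eqxx (negPf n2) /= ?andbF ?orbF.
by rewrite /= orbCA.
Qed.

(** A contraction never removes a loop, and in the last element of a derivation all variables are
    fixed. *)
Lemma ev_loop i A e c x : ev i A e -> wf i A ->
  c \in A -> x \in supp c -> i x \in supp c -> i x = x.
Proof.
move=> Ae; elim: Ae c => {A e} [e ie|A c1 x1 d1 e E _ IH] c Awf.
  by move=> /fset1P -> xe _; apply: ie.
move=> cA xc ixc; have := E; case/edgeP=> cA1 dA1 cd1 xc1 xd1.
have [xnd xnc] := edge_notin Awf E; have x1K := edge_invK Awf E.
have [xx|xx] := eqVneq x x1.
  subst x1; rewrite -(wf_eq Awf cA cA1 xc xc1) in cd1.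
  by case/eqP: cd1; apply: (wf_eq Awf cA dA1 ixc xd1).
have [xi|xi] := eqVneq x (i x1).
  rewrite xi x1K in xc ixc.
  by case/eqP: cd1; rewrite -(wf_eq Awf cA cA1 ixc xc1); apply: (wf_eq Awf cA dA1 xc xd1).
have [ix|ix] := eqVneq (i x) x1.
  by case/eqP: xi; rewrite -ix (wf_inv Awf) //; exists c.
have [ixi|ixi] := eqVneq (i x) (i x1).
  case/eqP: xx; rewrite -x1K -ixi (wf_inv Awf) //; by exists c.
have IH' := IH _ (wf_contract Awf E).
have [cc|cc] := boolP ((c == c1) || (c == d1)); last first.
  move: cc; rewrite negb_or => /andP[n1 n2]; apply: (IH' c) => //.
  by rewrite mem_contract cA n1 n2 orbT.
have cU z : z \in supp c -> z \in supp c1 `|` supp d1.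
  by rewrite inE; case/orP: cc => /eqP <- ->; rewrite ?orbT.
apply: (IH' (comp c1 x1 (i x1) d1)); first by rewrite mem_contract eqxx.
  by rewrite (supp_edge Awf) // in_fsetD1 xi in_fsetD1 xx cU.
by rewrite (supp_edge Awf) // in_fsetD1 ixi in_fsetD1 ix cU.
Qed.

Lemma ev_contract_adj i A c x d u e v : wf i A ->
  edge i A c x d -> edge i A d u e -> c != e ->
  (forall c' x' d', edge i (contract i A c x d) c' x' d' ->
     ev i (contract i (contract i A c x d) c' x' d') v) ->
  ev i (contract i A d u e) v.
Proof.
move=> Awf E E' ce IH; have [F F' eq] := contract_adj Awf E E' ce.
by apply: (ev_step F'); rewrite -eq; apply: IH.
Qed.

(** The given edge is compared with the first edge of the derivation. If they differ, the two
    contractions commute, and the induction hypothesis applies after the first one. Uniqueness of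
    the value follows by inverting one derivation along the other. *)
Lemma ev_contract i A e : ev i A e -> wf i A -> forall c x d,
  edge i A c x d -> ev i (contract i A c x d) e.
Proof.
elim=> {A e} [e _ _ c x d|A c1 x1 d1 e E1 ev1 IH Awf c x d E].
  by case/edgeP=> /fset1P -> /fset1P ->; rewrite eqxx.
have {}IH := IH (wf_contract Awf E1).
have := E; case/edgeP=> cA dA cd xc xd; have := E1; case/edgeP=> cA1 dA1 cd1 xc1 xd1.
have x1K := edge_invK Awf E1.
have [xx|xx] := eqVneq x x1.
  subst x; rewrite (wf_eq Awf cA cA1 xc xc1) (wf_eq Awf dA dA1 xd xd1) //.
have [xi|xi] := eqVneq x (i x1).
  subst x; rewrite x1K in xd.
  rewrite (wf_eq Awf cA dA1 xc xd1) (wf_eq Awf dA cA1 xd xc1).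
  by rewrite (contract_sym Awf).
have E1' := edge_sym Awf E1; have E' := edge_sym Awf E.
have IH' c' x' d' : edge i (contract i A d1 (i x1) c1) c' x' d' ->
    ev i (contract i (contract i A d1 (i x1) c1) c' x' d') e.
  by rewrite (contract_sym Awf E1); apply: IH.
(* Two parallel edges cannot occur: contracting one makes the other a loop, against [ev_loop]. *)
have par : ~ ((c = c1 /\ d = d1) \/ (c = d1 /\ d = c1)).
  move=> H.
  have ixx : i x != x1.
    by apply: contra xi => /eqP <-; rewrite (edge_invK Awf E).
  have ixi : i x != i x1.
    by apply: contra xx => /eqP e'; rewrite -x1K -e' (edge_invK Awf E).
  have xk : x \in supp (comp c1 x1 (i x1) d1).
    rewrite (supp_edge Awf) // in_fsetD1 xi in_fsetD1 xx inE.
    by case: H => -[<- <-]; rewrite xc ?orbT.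
  have ixk : i x \in supp (comp c1 x1 (i x1) d1).
    rewrite (supp_edge Awf) // in_fsetD1 ixi in_fsetD1 ixx inE.
    by case: H => -[<- <-]; rewrite xd ?orbT.
  have := ev_loop ev1 (wf_contract Awf E1) _ xk ixk.
  rewrite mem_contract eqxx => /(_ isT) ix.
  by case/eqP: cd; apply: (wf_eq Awf cA dA xc); rewrite -ix.
(* A single common end can lie in four positions; reversing one or both edges brings each of them to
   the form of [contract_adj]. *)
have [cd1'|cd1'] := eqVneq d1 c.
  subst c; apply: (ev_contract_adj Awf E1 E) => //.
  by apply/eqP => h; apply: par; right.
have [cc1'|cc1'] := eqVneq c1 c.
  subst c; apply: (ev_contract_adj Awf E1' E) => //.
  by apply/eqP => h; apply: par; left.
rewrite -(contract_sym Awf E).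
have [dd1'|dd1'] := eqVneq d1 d.
  subst d; apply: (ev_contract_adj Awf E1 E') => //.
have [dc1'|dc1'] := eqVneq c1 d.
  subst d; apply: (ev_contract_adj Awf E1' E') => //.
rewrite (contract_sym Awf E).
have [F F' eq] := contract_far Awf E1 E cc1' dc1' cd1' dd1'.
by apply: (ev_step F'); rewrite -eq; apply: IH.
Qed.

Lemma ev_uniq i A e e' : wf i A -> ev i A e -> ev i A e' -> e = e'.
Proof.
move=> Awf Ae; elim: Ae Awf => {A e} [e _ Awf|A c x d e E _ IH Awf] Ae'.
  case: {-2}_ _ / Ae' (erefl [fset e]) => [e1 _ /fset1_inj //|A c x d e1].
  by case/edgeP=> cA dA cd _ _ _ eA; move: cA dA cd; rewrite eA => /fset1P-> /fset1P->; rewrite eqxx.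
by apply: IH; [apply: wf_contract|apply: ev_contract].
Qed.

Lemma ev_supp i A e x : ev i A e -> wf i A ->
  (x \in supp e) <-> (on A x /\ i x = x).
Proof.
elim=> {A e} [e ie|A c y d e E _ IH] Awf.
  split=> [xe|[[c /fset1P -> ]]//]; split; last exact: ie.
  by exists e; rewrite ?inE.
rewrite IH; last exact: wf_contract.
rewrite (on_contract Awf) //; split=> [[[] //]|[xA ix]]; do 2!split=> //; apply/eqP => h.
  have := E; case/edgeP=> cA dA /eqP cd xc xd; apply: cd.
  by apply: (wf_eq Awf cA dA xc); rewrite -h -ix h.
have := E; case/edgeP=> cA dA /eqP cd xc xd; apply: cd.
by apply: (wf_eq Awf cA dA xc); rewrite -(edge_invK Awf E) -h ix h.
Qed.

Lemma eq_ev i i' A e : wf i A -> (forall x, on A x -> i x = i' x) ->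
  ev i A e -> ev i' A e.
Proof.
move=> Awf ii Ae; elim: Ae Awf ii => {A e} [e ie|A c x d e E _ IH] Awf ii.
  by apply: ev_one => x xe; rewrite -ii ?ie //; exists e; rewrite ?inE.
have xA := edge_on E.
have E' : edge i' A c x d by rewrite /edge -ii.
apply: (ev_step E'); rewrite /contract -ii //; apply: IH; first exact: wf_contract.
by move=> y /(on_contract Awf _ E)[yA _ _]; apply: ii.
Qed.

(** A subfamily may be evaluated first. Only the inner edges of [A] must be kept by [i']; a fixed
    variable of [i] may be joined by [i'] to something else, as happens to the free variables of a
    tree substituted for a corolla. *)
Lemma ev_lift i i' A B e v : ev i A e -> wf i A ->
  (forall c d x, c \in A -> d \in B -> x \in supp c -> x \in supp d -> False) ->
  (forall x, on A x -> i x != x -> i' x = i x) ->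
  ev i' (e |` B) v -> ev i' (A `|` B) v.
Proof.
move=> Ae; elim: Ae => {A e} [//|A c x d e E _ IH] Awf AB ii ev'.
have := E; case/edgeP=> cA dA cd xc xd.
have ix : i' x = i x.
  apply: ii; first by exists c.
  by apply: contra (edge_notin Awf E).1 => /eqP <-.
have E' : edge i' (A `|` B) c x d by rewrite /edge ix !inE cA dA cd xc xd.
apply: (ev_step E').
have -> : contract i' (A `|` B) c x d = contract i A c x d `|` B.
  apply/fsetP => a; rewrite !inE ix.
  have [aB|] := boolP (a \in B); last by rewrite !orbF.
  rewrite !orbT !andbT; apply/orP; right; apply/andP; split; apply/eqP => h.
    by apply: (AB d a (i x)) => //; rewrite h.
  by apply: (AB c a x) => //; rewrite h.
apply: IH => //; first exact: wf_contract.
  move=> c' d' z c'A d'B zc zd.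
  have /(on_contract Awf _ E)[[a aA za] _ _]: on (contract i A c x d) z by exists c'.
  exact: AB za zd.
by move=> z /(on_contract Awf _ E)[zA _ _]; apply: ii.
Qed.

(** (EQ) at every contraction: the renamed family is contracted along the renamed edges. *)
Lemma ev_rn i i' r A e : wf i A ->
  (forall x y, on A x -> on A y -> r x = r y -> x = y) ->
  (forall x, on A x -> i' (r x) = r (i x)) ->
  ev i A e -> ev i' (rn r @` A) (rn r e).
Proof.
move=> Awf rI ri Ae; elim: Ae Awf rI ri => {A e} [e ie|A c x d e E _ IH] Awf rI ri.
  have one z : z \in supp e -> on [fset e] z by exists e; rewrite ?inE.
  rewrite imfset_fset1; apply: ev_one => x; rewrite supp_rn.
    by case/imfsetP=> y /= ye ->; rewrite ri ?ie //; apply: one.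
  by move=> y z ye ze; apply: rI; apply: one.
have := E; case/edgeP=> cA dA cd xc xd.
have onA a z : a \in A -> z \in supp a -> on A z by exists a.
have rIa a : a \in A -> {in supp a &, injective r}.
  by move=> aA y z ya za; apply: rI; apply: onA aA _.
have rxi : i' (r x) = r (i x) by apply: ri; apply: onA xc.
have memr a z : a \in A -> on A z -> (r z \in supp (rn r a)) = (z \in supp a).
  move=> aA zA; rewrite supp_rn; last exact: rIa.
  apply/imfsetP/idP => /= [[y ya /rI e']|za]; last by exists z.
  by rewrite e' //; apply: onA ya.
have neq a b z : a \in A -> b \in A -> z \in supp a -> rn r a = rn r b -> a = b.
  move=> aA bA za e'; apply: (wf_eq Awf aA bA za).
  by rewrite -memr // -?e' ?memr //; apply: onA za.
have E' : edge i' (rn r @` A) (rn r c) (r x) (rn r d).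
  apply/edgeP; rewrite !in_imfset // rxi !memr //; try exact: (onA d); try exact: (onA c).
  by split=> //; apply: contra cd => /eqP /(neq _ _ x cA dA xc) ->.
apply: (ev_step E').
suff -> : contract i' (rn r @` A) (rn r c) (r x) (rn r d) = rn r @` contract i A c x d.
  apply: IH => [|y z|y]; first exact: wf_contract.
    by move=> /(on_contract Awf _ E)[? _ _] /(on_contract Awf _ E)[? _ _]; apply: rI.
  by move=> /(on_contract Awf _ E)[? _ _]; apply: ri.
have k : rn r (comp c x (i x) d) = comp (rn r c) (r x) (i' (r x)) (rn r d).
  rewrite rxi ecomp_rn //; first exact: (edge_joinable Awf E).
    exact: (wf_disjoint Awf).
  move=> y z; rewrite !inE => Y Z.
  apply: rI; [case/orP: Y|case/orP: Z] => H; by [apply: onA cA H|apply: onA dA H].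
apply/fsetP => a; rewrite mem_contract; apply/predU1P/imfsetP => /=.
  case=> [->|/and3P[ad ac /imfsetP[/= b bA ab]]].
    by exists (comp c x (i x) d); rewrite ?mem_contract ?eqxx.
  exists b => //; rewrite mem_contract bA andbT; apply/orP; right.
  by apply/andP; split; [apply: contra ad|apply: contra ac] => /eqP <-; rewrite ab.
case=> b; rewrite mem_contract => /predU1P[->->|/and3P[bd bc bA] ->]; first by left.
right; rewrite in_imfset // andbT; apply/andP; split; apply/eqP => h.
  by case/eqP: bd; apply/esym/(neq d b (i x)).
by case/eqP: bc; apply/esym/(neq c b x).
Qed.

End Contraction.

(** * Every tree has a value *)

Section Existence.

Variables (V : choiceType) (C : species V) (O : cyclic_operad C).
Implicit Types (a b c d e : elt C) (x y z u : V) (i r : V -> V) (A : {fset elt C}).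

Local Notation comp := (ecomp O).

(** Connectedness without paths: a predicate that propagates along edges and holds at one element
    holds at all. *)
Definition connected_on i A : Prop := forall Q : elt C -> Prop,
  {in A &, forall c d y, y \in supp c -> i y \in supp d -> Q c -> Q d} ->
  {in A &, forall c d, Q c -> Q d}.

(* Deleting an edge of a tree splits its variables into two sides. *)
Definition cut_on i A : Prop := forall x, on A x -> i x != x ->
  exists P : V -> Prop,
  [/\ {in A, forall c y z, y \in supp c -> z \in supp c -> P y -> P z}, P x, ~ P (i x) &
      forall z, on A z -> z != x -> z != i x -> P z -> P (i z)].

Lemma connected_contract i A c x d : wf i A -> edge i A c x d ->
  connected_on i A -> connected_on i (contract O i A c x d).
Proof.
move=> Awf E Ac Q' Q'P; have := E; case/edgeP=> cA dA cd xc xd.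
(* The map [phi] collapses both ends of the edge to the composite; a predicate on the contracted
   family is pulled back along it. *)
pose k := comp c x (i x) d; pose phi a := if (a == c) || (a == d) then k else a.
have phiA a : a \in A -> phi a \in contract O i A c x d.
  rewrite /phi mem_contract; case: ifP => [_|/norP[ac ad] aA]; first by rewrite eqxx.
  by rewrite ac ad aA orbT.
have phiS a z : a \in A -> z \in supp a -> z != x -> z != i x -> z \in supp (phi a).
  move=> aA za zx zi; rewrite /phi; case: ifP => // h.
  rewrite (supp_edge O Awf) // !inE zx zi /=.
  by case/orP: h => /eqP <-; rewrite za ?orbT.
have phi_ex a : a \in contract O i A c x d -> exists2 b, b \in A & a = phi b.
  rewrite mem_contract => /predU1P[->|/and3P[ad ac aA]].
    by exists c; rewrite // /phi eqxx.
  by exists a; rewrite // /phi (negPf ac) (negPf ad).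
move=> a' b' /phi_ex[a aA ->] /phi_ex[b bA ->].
apply: (Ac (Q' \o phi)) => // {aA bA}a {}b aA bA y ya yb /=.
have [yx|yx] := eqVneq y x.
  subst y; rewrite (wf_eq Awf aA cA ya xc) (wf_eq Awf bA dA yb xd).
  by rewrite /phi !eqxx orbT.
have [yi|yi] := eqVneq y (i x).
  rewrite yi (edge_invK Awf E) in ya yb.
  rewrite (wf_eq Awf aA dA ya xd) (wf_eq Awf bA cA yb xc).
  by rewrite /phi !eqxx orbT.
have yA : on A y by exists a.
have iyx : i y != x by apply: contra yi => /eqP <-; rewrite (wf_inv Awf).
have iyi : i y != i x.
  by apply: contra yx => /eqP e; rewrite -(edge_invK Awf E) -e (wf_inv Awf).
by apply: (Q'P _ _ _ _ y); rewrite ?phiA ?phiS.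
Qed.

(** A side is a predicate on variables, so it can be kept unchanged. It is constant on the composite
    because the contracted edge is not the deleted one, and hence has both its ends on the same
    side. *)
Lemma cut_contract i A c x d : wf i A -> edge i A c x d ->
  cut_on i A -> cut_on i (contract O i A c x d).
Proof.
move=> Awf E Ac y /(on_contract O Awf _ E)[yA yx yi] iy.
have [P [PA Py Piy Pi]] := Ac y yA iy; have := E; case/edgeP=> cA dA cd xc xd.
have xA := edge_on E; have ixA := wf_on Awf xA.
have ixy : i x != i y.
  by apply: contra yx => /eqP e; rewrite -(edge_invK Awf E) e (wf_inv Awf).
have xiy : x != i y by apply: contra yi => /eqP ->; rewrite (wf_inv Awf).
have Px : P x <-> P (i x).
  split=> [|h]; first by apply: Pi; rewrite // eq_sym.
  by rewrite -(edge_invK Awf E); apply: Pi; rewrite // eq_sym.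
have Pk z : z \in supp (comp c x (i x) d) -> P z <-> P x.
  rewrite (supp_edge O Awf) // !inE => /and3P[_ _ /orP[zc|zd]].
    by split; apply: (PA c).
  by rewrite Px; split; apply: (PA d).
exists P; split=> //.
  move=> a; rewrite mem_contract => /predU1P[->|/and3P[_ _ aA]]; last exact: PA.
  by move=> z z' /Pk -> /Pk ->.
by move=> z /(on_contract O Awf _ E)[zA _ _]; apply: Pi.
Qed.

(** Each contraction lowers the number of elements. When no edge is left, connectedness leaves a
    single element, and a variable moved by [i] would have its partner in that element, hence on its
    own side of the cut. *)
Lemma ev_exists i A : wf i A -> connected_on i A -> cut_on i A -> A != fset0 ->
  exists e, ev O i A e.
Proof.
have [n] := ubnP #|` A|; elim: n A => // n IHn A An Awf Ac At A0.
have [[c [x [d E]]]|noE] := pselect (exists c x d, edge i A c x d).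
  have := E; case/edgeP=> cA dA cd xc xd.
  case: (IHn (contract O i A c x d)) => [|||||e Ae].
  - have cA1 : #|` A| = #|` A `\ c `\ d|.+2.
      by rewrite (cardfsD1 c A) cA (cardfsD1 d (A `\ c)) !inE eq_sym cd dA.
    move: An; rewrite cA1 ltnS; apply: leq_trans; rewrite ltnS /contract.
    by rewrite cardfsU1; case: (_ \notin _).
  - exact: wf_contract.
  - exact: connected_contract.
  - exact: cut_contract.
  - by apply/fset0Pn; exists (comp c x (i x) d); rewrite mem_contract eqxx.
  by exists e; apply: ev_step E Ae.
have /fset0Pn[c cA] := A0.
have AE : A = [fset c].
  apply/fsetP => a; rewrite inE; apply/idP/eqP => [aA|->//].
  apply/esym; apply: (Ac (fun a => c = a)) cA aA _ => //.
  move=> b d bA dA y yb yd cb; subst b; apply: contrapT => /eqP cd.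
  by apply: noE; exists c, y, d; apply/edgeP.
exists c; rewrite AE; apply: ev_one => y yc.
have yA : on A y by exists c.
have iyc : i y \in supp c.
  by have [a aA] := wf_on Awf yA; move: (aA); rewrite AE => /fset1P ->.
apply/eqP; apply: contrapT => /negP iy.
by have [P [PA Py nP _]] := At y yA iy; apply: nP; apply: PA yc iyc Py.
Qed.

Variable par : corolla C -> elt C.
Hypothesis supp_par : forall c : corolla C, supp (par c) = FV c.

Implicit Type T : graph C.

Lemma par_onP T x : on (par @` cor T) x <-> x \in vars T.
Proof.
split=> [[_ /imfsetP[/= c cT ->]]|/varsP[c cT xc]].
  by rewrite supp_par => xc; apply/varsP; exists c.
by exists (par c); rewrite ?supp_par // in_imfset.
Qed.

Lemma FV_inj T (c d : corolla C) x : is_graph T -> c \in cor T -> d \in cor T ->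
  x \in FV c -> x \in FV d -> c = d.
Proof.
case=> _ Td _ _ cT dT xc xd; apply/eqP; apply: contrapT => /negP cd.
by move/fdisjointP: (Td _ _ cT dT cd) => /(_ x xc); rewrite xd.
Qed.

Lemma wf_par T : is_graph T -> wf (inv T) (par @` cor T).
Proof.
move=> Tg; have [_ Td Ti Tii] := Tg; split.
- move=> _ _ x /imfsetP[/= c cT ->] /imfsetP[/= d dT ->]; rewrite !supp_par.
  by move=> xc xd; rewrite (FV_inj Tg cT dT xc xd).
- by move=> x /par_onP xT; apply/par_onP; apply: Ti.
- by move=> x /par_onP; apply: Tii.
Qed.

Lemma connected_par T : is_etree T -> connected_on (inv T) (par @` cor T).
Proof.
case=> Tg [Tc _ _ _] Q QP _ _ /imfsetP[/= c cT ->] /imfsetP[/= d dT ->].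
have [p pp ->] := Tc _ _ cT dT; elim: p c cT pp => //= e p IHp c cT.
case/andP=> /and3P[_ eT /existsP[[/= y yc] /andP[ye _]]] ep Qc.
apply: IHp => //; apply: (QP (par c) (par e) _ _ y) => //; rewrite ?in_imfset //.
  by rewrite supp_par.
by rewrite supp_par.
Qed.

(** The side of [x] consists of the variables of all corollas reachable from the corolla [c] of [x]
    by steps [adj'], which avoid the edge of [x]. *)
Lemma cut_par T : is_etree T -> cut_on (inv T) (par @` cor T).
Proof.
case=> Tg [_ Tl Tm Ty] x /par_onP xT ixx; have [_ _ Ti Tii] := Tg.
have /varsP[c cT xc] := xT; have /varsP[d dT xd] := Ti x xT.
pose adj' (a b : corolla C) := [&& a \in cor T, b \in cor T &
  [exists z : FV a, [&& inv T (val z) \in FV b, inv T (val z) != val z,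
     val z != x & val z != inv T x]]].
have adjW (a b : corolla C) : adj' a b -> adj T a b.
  case/and3P=> aT bT /existsP[z /and4P[zb zz _ _]]; rewrite /adj aT bT.
  by apply/existsP; exists z; rewrite zb.
pose conn (a : corolla C) := exists2 p, path adj' c p & a = last c p.
exists (fun z => exists2 a : corolla C, a \in cor T & z \in FV a /\ conn a); split.
- move=> _ /imfsetP[/= a aT ->] y z; rewrite !supp_par => ya za [b bT [yb cb]].
  by exists a => //; rewrite (FV_inj Tg aT bT ya yb) in za *.
- by exists c => //; split=> //; exists [::].
- case=> a aT [ia]; rewrite (FV_inj Tg aT dT ia xd) => -[p0 pp0 dp0].
  move: dp0; case/shortenP: pp0 => p pp up _ {p0} dp.
  have cd : c != d.
    by apply: contra ixx => /eqP cd; rewrite (Tl c) // cd.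
  (* An empty path would make the edge a loop, a path of length one a multiple edge, and a longer
     duplicate-free path closes up with the edge to a cycle. *)
  case: p pp up dp => [_ _ /= /eqP|e [|f p] pp up dp].
  + by rewrite eq_sym (negPf cd).
  + move: pp dp => /= /andP[/and3P[_ _ /existsP[[/= z zc] /and4P[zd zz zx _]]] _] de.
    subst e; case/eqP: zx; exact: (Tm c d cT dT z x).
  have /negP := Ty (c :: e :: f :: p) isT up; apply.
  rewrite /cycle rcons_path (sub_path adjW pp) -dp /adj dT cT /=.
  by apply/existsP; exists [` xd]; rewrite /= Tii // xc eq_sym.
- move=> z /par_onP zT zx zi [a aT [za [p pp pa]]].
  have /varsP[b bT zb] := Ti z zT; exists b => //; split=> //.
  have [iz|iz] := eqVneq (inv T z) z.
    by exists p => //; rewrite -pa; apply: (FV_inj Tg bT aT zb); rewrite iz.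
  exists (rcons p b); last by rewrite last_rcons.
  rewrite rcons_path pp -pa /adj' aT bT /=.
  by apply/existsP; exists [` za]; rewrite /= zb iz zx zi.
Qed.

Lemma ev_par T : is_etree T ->
  exists2 e, ev O (inv T) (par @` cor T) e & supp e = free T.
Proof.
move=> Te; have Tg : is_graph T by case: Te.
have [|e Ae] := ev_exists (wf_par Tg) (connected_par Te) (cut_par Te).
  have [/fset0Pn[c cT] _ _ _] := Tg; apply/fset0Pn; exists (par c).
  by rewrite in_imfset.
exists e => //; apply/fsetP => x; rewrite !inE /=.
apply/idP/andP => [/(ev_supp _ Ae (wf_par Tg))[/par_onP ? ->]|[xT /eqP ix]] //.
by apply/(ev_supp _ Ae (wf_par Tg)); split=> //; apply/par_onP.
Qed.

End Existence.

Lemma single_etree (V : choiceType) (C : species V) (T : graph C) c :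
  cor T = [fset c] -> {in FV c, inv T =1 id} -> is_etree T.
Proof.
move=> cT ic; have vT x : x \in vars T -> x \in FV c.
  by case/varsP=> d; rewrite cT => /fset1P ->.
split; split; rewrite ?cT.
- by apply/fset0Pn; exists c; rewrite inE.
- by move=> d d' /fset1P -> /fset1P ->; rewrite eqxx.
- by move=> x xT; rewrite ic // vT.
- by move=> x xT; rewrite !ic // ?ic vT.
- by move=> d d' /fset1P -> /fset1P ->; exists [::].
- by move=> d /fset1P -> x xc _; apply: ic.
- by move=> d d' /fset1P -> /fset1P ->; rewrite eqxx.
case=> // d [|d' s] // _ _; apply/negP => /= /andP[/and3P[]].
rewrite cT => /fset1P -> _ /existsP[x /andP[_]]; by rewrite ic ?eqxx ?fsvalP.
Qed.

(** * The algebra of a cyclic operad *)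

Section AlgebraOfOperad.

Variables (V : choiceType) (C : species V) (O : cyclic_operad C).
Implicit Types (c d : corolla C) (e : elt C) (x y z u : V) (r : V -> V).
Implicit Types (T U : graph C) (X : {fset V}).

(* Special corollas are evaluated as units, so that the reductions of normal
   forms become contractions of edges. *)
Definition par c : elt C :=
  match c with Ord X f => elm f | Spec X h => elm (co_id O h) end.

Lemma supp_par c : supp (par c) = FV c.
Proof. by case: c. Qed.

Definition evT T e : Prop := ev O (inv T) (par @` cor T) e.

Let wfT T : is_graph T -> wf (inv T) (par @` cor T).
Proof. exact: (wf_par supp_par). Qed.

Lemma evT_uniq T e e' : is_graph T -> evT T e -> evT T e' -> e = e'.
Proof. by move=> /wfT; apply: ev_uniq. Qed.

Lemma evT_supp T e x : is_graph T -> evT T e -> x \in supp e -> x \in free T.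
Proof.
move=> /wfT Twf /ev_supp/(_ Twf) h /h[/(par_onP supp_par) xT ix].
by rewrite !inE /= xT ix eqxx.
Qed.

(** For special corollas this is (U3). *)
Lemma par_ren r c c' : {in FV c &, injective r} -> ren_cor r c c' ->
  par c' = rn r (par c).
Proof.
case: c c' => [X f|X h] [X' f'|X' h'] //= rI; first exact: ren_cor_rn.
move=> e; subst X'; have [s sE] := bij_of_renaming rI.
by rewrite (rnE _ sE) co_U3.
Qed.

Lemma evT_renaming r T T' e : is_graph T -> renaming r T T' ->
  evT T e -> evT T' (rn r e).
Proof.
move=> Tg rT; have [phi phiC phiP] := renaming_fun rT.
have -> : evT T' (rn r e) = ev O (inv T') (rn r @` (par @` cor T)) (rn r e).
  rewrite /evT phiC -!imfset_comp; congr (ev _ _ _ _).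
  apply: eq_in_imfset => c cT /=; apply: par_ren (phiP c cT).
  by move=> x y xc yc; case: rT => rI _ _; apply: rI; apply: FV_vars; eassumption.
case: rT => rI _ ri; apply: ev_rn; first exact: wfT.
  by move=> x y /(par_onP supp_par) xT /(par_onP supp_par) yT; apply: rI.
by move=> x /(par_onP supp_par) xT; apply: ri.
Qed.

(** The value is supported on the free variables, which the renaming fixes. *)
Lemma evT_alpha T T' e : is_graph T -> alpha T T' -> evT T e -> evT T' e.
Proof.
move=> Tg [r rid rT] Te; rewrite -(@rn_id _ _ r e) => [|x xe].
  exact: evT_renaming rT Te.
by apply: rid; apply: evT_supp xe.
Qed.

Lemma evT_class (P : graph C -> Prop) X (q : class_of P X) T T' e :
  (forall T, P T -> is_graph T) -> class_set q T -> class_set q T' ->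
  evT T e -> evT T' e.
Proof.
move=> PG; have [T0 [/PG T0g _ ->]] /= := classP q => aT aT' Te.
apply: evT_alpha aT' _ => //; apply: evT_alpha (alpha_sym T0g aT) Te.
case: aT => r _ rT; have [phi phiC phiP] := renaming_fun rT.
case: rT => rI _ ri; apply: transport_graph phiC _ rI ri T0g.
by move=> c cT; apply: ren_cor_FV (phiP c cT).
Qed.

Lemma delta_ex X (q : T_ C X) : exists v : C X,
  forall T, class_set q T -> evT T (elm v).
Proof.
have [T qT] := T_P q; have [[Te _] fT qE] := T_mem qT.
have Tg : is_graph T by case: Te.
have [e Ae] := ev_par O supp_par Te; rewrite fT => eX.
exists (elt_cast eX) => T'; rewrite elt_castE qE => aT.
exact: evT_alpha aT Ae.
Qed.

Definition delta X (q : T_ C X) : C X := projT1 (cid (delta_ex q)).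

Lemma deltaP X (q : T_ C X) T : class_set q T -> evT T (elm (delta q)).
Proof. by move=> qT; apply: (projT2 (cid (delta_ex q))). Qed.

Lemma delta_nat X' X (s : bij X' X) (q : TT C X) : delta (q ^^ s) = delta q ^^ s.
Proof.
have [T qT] := T_P q; have [[[Tg _] _] fT qE] := T_mem qT.
have [r rI rE] := bij_extend s.
have [T1 rT1] := renaming_ex (T := T) (in2W rI) Tg.
have q1 : class_set (q ^^ s) T1 by exists T => //; exists r.
have [[[T1g _] _] _ _] := T_mem q1.
apply: elm_inj; apply: evT_uniq T1g (deltaP q1) _.
rewrite -(rnE _ rE); exact: evT_renaming rT1 (deltaP qT).
Qed.

Definition delta_nt : nat_trans (TT C) C := @NatTrans V (TT C) C delta delta_nat.

Lemma delta_eta X (f : C X) : delta (eta f) = f.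
Proof.
have [Gg _] := @single_etree _ _ (Graph [fset Ord f] id) (Ord f) erefl (in1W (frefl id)).
apply: elm_inj; apply: (evT_uniq Gg).
  by apply: (deltaP (q := eta f)); apply: alpha_refl.
by rewrite /evT imfset_fset1; apply: ev_one.
Qed.

(** Transfers a contraction from values to corollas. Although [par] need not be injective, a corolla
    of [T] with a variable is determined by its value, and both ends of an edge have one. *)
Lemma ev_contract_par T c d x k e : is_graph T ->
  c \in cor T -> d \in cor T -> c != d -> x \in FV c -> inv T x \in FV d ->
  ecomp O (par c) x (inv T x) (par d) = par k ->
  ev O (inv T) (par @` (k |` (cor T `\ c `\ d))) e -> evT T e.
Proof.
move=> Tg cT dT cd xc xd kE.
have neq a b y : a \in cor T -> b \in cor T -> y \in FV b -> par a = par b -> a = b.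
  move=> aT bT yb ab; apply: (FV_inj Tg aT bT _ yb).
  by rewrite -supp_par ab supp_par.
have E : edge (inv T) (par @` cor T) (par c) x (par d).
  apply/edgeP; rewrite !in_imfset // !supp_par; split=> //.
  by apply: contra cd => /eqP /(neq _ _ _ cT dT xd) ->.
move=> h; apply: (ev_step E); suff <- : par @` (k |` (cor T `\ c `\ d)) =
  contract O (inv T) (par @` cor T) (par c) x (par d) by [].
apply/fsetP => a; rewrite mem_contract kE; apply/imfsetP/predU1P => /=.
  case=> b; rewrite !inE => /predU1P[-> ->|/and3P[bd bc bT] ->]; first by left.
  right; rewrite in_imfset // andbT; apply/andP; split.
    by apply: contra bd => /eqP /(neq _ _ _ bT dT xd) ->.
  by apply: contra bc => /eqP /(neq _ _ _ bT cT xc) ->.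
case=> [->|/and3P[ad ac /imfsetP[/= b bT ab]]]; first by exists k; rewrite ?inE ?eqxx.
exists b => //; rewrite !inE bT andbT; apply/orP; right.
by apply/andP; split; [apply: contra ad|apply: contra ac] => /eqP <-; rewrite ab.
Qed.

(** A reduction is the contraction of an edge at a special corolla. At an ordinary corolla this is
    (U1). For two special ones, (U1) turns the composite of the units into a renaming of the first,
    and (U3) identifies this with the unit of the new corolla. *)
Lemma evT_step T T' e : is_graph T -> is_graph T' -> step T T' ->
  evT T' e -> evT T e.
Proof.
move=> Tg Tg' st; have Twf' := wfT Tg'.
case: st => [X f x y z h t fT hT xX ixy tr cT' iT'|
             x y u v hxy huv hxv xyT uvT ne iyu cT' iT'] Te.
  have yh : inv T x \in FV (Spec h : corolla C) by rewrite /= ixy !inE eqxx.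
  have neq : Ord f != Spec h :> corolla C by apply/eqP.
  have dis : fdisjoint (X `\ x) ([fset y; z] `\ y).
    case: Tg => _ Td _ _; apply/fdisjointP => a; rewrite !inE => /andP[_ aX].
    have /fdisjointP/(_ a aX) := Td _ _ fT hT neq.
    by rewrite /= !inE => /negPf ->; rewrite andbF.
  have yz : y \in [fset y; z] by rewrite !inE eqxx.
  apply: (@ev_contract_par T (Ord f) (Spec h) x (Ord (f ^^ t))) => //.
    rewrite /= ixy (ecompE O f (co_id O h) xX yz dis).
    exact: co_U1.
  rewrite -cT'; apply: eq_ev Twf' _ Te => x' /(par_onP supp_par); exact: iT'.
have neq : Spec hxy != Spec huv :> corolla C by apply: contra ne => /eqP/(congr1 (@FV V C)) /= ->.
have yxy : y \in [fset x; y] by rewrite !inE eqxx orbT.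
have uuv : u \in [fset u; v] by rewrite !inE eqxx.
have xy : x != y by move: (hxy); rewrite cardfs2; case: (x != y).
have xv : x != v by move: (hxv); rewrite cardfs2; case: (x != v).
have dis0 : fdisjoint [fset x; y] [fset u; v].
  by case: Tg => _ Td _ _; apply: Td uvT neq.
have dis : fdisjoint ([fset x; y] `\ y) ([fset u; v] `\ u).
  apply/fdisjointP => a; rewrite in_fsetD1 => /andP[_ axy].
  by have /fdisjointP/(_ a axy) := dis0; rewrite in_fsetD1 => /negPf ->; rewrite andbF.
pose r a := if a == y then v else a.
have xyv : [fset x; y] `\ y `|` [fset v] = r @` [fset x; y].
  rewrite imfsetU !imfset_fset1 /r eqxx (negPf xy); congr (_ `|` _).
  by apply/fsetP => a; rewrite !inE; have [->|] := eqVneq a y;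
    rewrite ?andbF ?orbF //= eq_sym (negPf xy).
have [|t tE] := bij_onto _ xyv.
  move=> a b /fset2P[] -> /fset2P[] ->; rewrite /r ?eqxx ?(negPf xy) //.
    by move=> e'; case/eqP: xv.
  by move=> e'; case/eqP: xv.
have tr : renames t.
  move=> w; move: (tE w); rewrite /r /=.
  case/fset2P: (fsvalP (t w)) => ->; last by rewrite eqxx => <-; rewrite eqxx.
  by rewrite (negPf xy) => <-; rewrite (negPf xv).
apply: (@ev_contract_par T (Spec hxy) (Spec huv) y (Spec hxv)) => //.
- by rewrite iyu.
- rewrite /= iyu (ecompE O (co_id O hxy) (co_id O huv) yxy uuv dis).
  rewrite /elm (co_U1 O (co_id O hxy) yxy uuv huv dis tr).
  have e' : [fset x; y] `\ y `|` [fset v] = [fset x; v].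
    by rewrite xyv imfsetU !imfset_fset1 /r eqxx (negPf xy).
  by move: t {tE tr} hxv {cT'} => /=; rewrite e' => t hxv; rewrite co_U3.
by rewrite -cT'; apply: eq_ev Twf' _ Te => x' /(par_onP supp_par); exact: iT'.
Qed.



Lemma evT_reduces X (q q' : eT C X) T T' e : reduces q q' ->
  class_set q T -> class_set q' T' -> evT T' e -> evT T e.
Proof.
have eG U : is_etree U -> is_graph U by case.
have mG Y (p : eT C Y) U : class_set p U -> is_graph U.
  move=> pU; have [U0 [U0e _ pE]] := classP p; move: pU; rewrite pE => /alpha_etree.
  by move=> /(_ U0e) [].
move=> qq'; elim: qq' T => {q q'} [q|q q1 q' U U1 qU q1U1 st _ IH] T qT q'T' Te.
  exact: evT_class eG q'T' qT Te.
apply: (evT_class eG qU qT); apply: (evT_step (mG _ _ _ qU) (mG _ _ _ q1U1) st).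
exact: IH.
Qed.

(** Starting from the tree whose parameters are the values of the inner trees, the corollas are
    expanded one at a time into these trees; [ev_lift] says that no expansion changes the value. *)
Lemma evT_flattens (T : graph (TT C)) U e : is_utree T -> is_graph U ->
  flattens T U -> evT (graph_map delta_nt T) e -> evT U e.
Proof.
move=> Tu Ug; have [[Gg _] _] := graph_map_utree delta_nt Tu; have [[Tg _] _] := Tu.
have Gwf := wfT Gg; pose G := graph_map delta_nt T; rewrite -/G in Gg Gwf *.
case=> [[X [h [cT cU UT]]] Ge|[To [R [RT Rd cU iU]]] Ge].
  have cG : cor G = [fset Spec h] by rewrite /= cT imfset_fset1.
  have -> : evT U e = ev O (inv U) (par @` cor G) e by rewrite /evT cU cG.
  apply: eq_ev Gwf _ Ge => x /(par_onP supp_par) /varsP[c].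
  by rewrite cG => /fset1P -> xX /=; rewrite -UT.
pose gam (c : corolla (TT C)) := par (cor_map delta_nt c).
have gamS (c : corolla (TT C)) : supp (gam c) = FV c by rewrite supp_par cor_map_FV.
have RP (c : corolla (TT C)) : c \in cor T -> [/\ is_graph (R c), free (R c) = FV c & evT (R c) (gam c)].
  move=> cT; have := To c cT; case: c cT => // X q cT _; have qR := RT X q cT.
  have [[[Rg _] _] fR _] := T_mem qR; split=> //; exact: deltaP qR.
have FVR (c : corolla (TT C)) x : c \in cor T -> x \in FV c -> x \in vars (R c).
  by move=> cT; have [_ <- _] := RP c cT; apply: free_vars.
have varsR (c c' : corolla (TT C)) x : c \in cor T -> c' \in cor T -> x \in vars (R c) ->
    x \in vars (R c') -> c = c'.
  move=> cT c'T xc xc'; apply/eqP; apply: contrapT => /negP cc'.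
  by move/fdisjointP: (Rd _ _ cT c'T cc') => /(_ x xc); rewrite xc'.
have ev0 : ev O (inv U) (gam @` cor T) e.
  have -> : gam @` cor T = par @` cor G by rewrite -imfset_comp.
  apply: eq_ev Gwf _ Ge => x /(par_onP supp_par).
  rewrite graph_map_vars => /varsP[c cT xc] /=; rewrite (iU c) ?FVR //.
  by have [_ -> _] := RP c cT; rewrite xc.
(* The intermediate stage: corollas in [s] are expanded, the others are still values. It runs from
   the tree of values at the empty list to the flattened tree at [cor T]. *)
pose A s := par @` (\bigcup_(c <- s) cor (R c)) `|`
            gam @` [fset c in cor T | c \notin s].
have evA s : uniq s -> {subset s <= cor T} -> ev O (inv U) (A s) e.
  elim: s => [_ _|c s IHs /= /andP[cs us] sT].
    rewrite /A big_nil imfset0 fset0U.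
    have -> // : [fset c in cor T | c \notin [::]] = cor T.
    by apply/fsetP => c; rewrite !inE /= andbT.
  have cT : c \in cor T by apply: sT; rewrite inE eqxx.
  have {}sT : {subset s <= cor T} by move=> d ds; apply: sT; rewrite inE ds orbT.
  have {}IHs := IHs us sT; have [Rg fR Re] := RP c cT.
  pose B := par @` (\bigcup_(d <- s) cor (R d)) `|`
            gam @` [fset d in cor T | d \notin c :: s].
  have -> : A (c :: s) = (par @` cor (R c)) `|` B.
    by rewrite /A /B big_cons imfsetU fsetUA.
  apply: ev_lift Re (wfT Rg) _ _ _.
  - move=> a b x /imfsetP[/= a' a'R ->]; rewrite supp_par => bB xa xb.
    have xR : x \in vars (R c) by apply: FV_vars a'R xa.
    have [d [ds dT xd]] : exists d : corolla (TT C), [/\ d != c, d \in cor T & x \in vars (R d)].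
      move: bB; rewrite inE => /orP[] /imfsetP[/= d dP bE]; rewrite bE in xb.
        have /bigfcupP[d' /andP[d's _] dd'] := dP.
        exists d'; split; [|exact: sT|].
          by apply: contra cs => /eqP <-.
        by rewrite supp_par in xb; apply: FV_vars dd' xb.
      move: dP; rewrite !inE /= negb_or => /and3P[dT dc _]; exists d; split=> //.
      by rewrite gamS in xb; apply: FVR.
    by case/eqP: ds; apply: varsR xd xR.
  - move=> x /(par_onP supp_par) xR ix; rewrite (iU c) //.
    by rewrite !inE /= xR (negPf ix).
  suff -> : gam c |` B = A s by [].
  rewrite /A /B fsetUCA; congr (_ `|` _).
  rewrite -(imfset_fset1 gam c) -imfsetU.
  have -> // : [fset c] `|` [fset d in cor T | d \notin c :: s] =
            [fset d in cor T | d \notin s].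
  apply/fsetP => d; rewrite !inE /= negb_or.
  by have [->|//] := eqVneq d c; rewrite cT cs.
have := evA (cor T) (fset_uniq _) (fun _ => id); rewrite /A -cU /evT.
suff -> : [fset c in cor T | c \notin (cor T : seq _)] = fset0 by rewrite imfset0 fsetU0.
by apply/fsetP => c; rewrite !inE /= andbN.
Qed.

Lemma delta_mu X (t : TT (TT C) X) (s : TT C X) : is_mu t s ->
  delta (T_hom delta_nt t) = delta s.
Proof.
case=> u [T [U [tT uU TU]]] [w uw ws]; apply: elm_inj.
have [Tu _ _] := T_mem tT.
have Ug : is_graph U.
  have [U1 [U1e _ uE1]] := classP u; move: uU; rewrite uE1 => /alpha_etree.
  by move=> /(_ U1e) [].
have [S sS] := T_P s.
have wS : class_set w S by rewrite ws.
have eS := deltaP sS; have eU := evT_reduces uw uU wS eS.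
have tG : class_set (T_hom delta_nt t) (graph_map delta_nt T).
  exists T => //; apply: alpha_refl.
  by have [[]] := graph_map_utree delta_nt Tu.
by apply: (evT_uniq Ug) eU; apply: (evT_flattens Tu Ug TU); apply: deltaP tG.
Qed.

Definition algebra_of_operad : M_algebra C :=
  @MAlgebra V C delta_nt delta_mu delta_eta.

End AlgebraOfOperad.

(** * Trees with at most three corollas *)

Section SmallTrees.

Variables (V : choiceType) (E : species V).
Implicit Types (T U : graph E) (a b c d : corolla E) (x y z u v : V).

(** The new corolla [d] is a leaf: its only neighbour is the corolla [c0] of [u], so it creates no
    cycle. Trees with two and three corollas arise by attaching leaves. *)
Lemma attach_etree T T' d u z : is_etree T -> fdisjoint (FV d) (vars T) ->
  u \in free T -> z \in FV d -> cor T' = d |` cor T ->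
  inv T' u = z -> inv T' z = u ->
  {in vars T, forall x, x != u -> inv T' x = inv T x} ->
  {in FV d, forall x, x != z -> inv T' x = x} -> is_etree T'.
Proof.
move=> [Tg [Tc Tl Tm Ty]] dis uT zd cT' iu iz iT id'.
have [T0 Td Ti Tii] := Tg.
have [uV /eqP uu] : u \in vars T /\ inv T u == u by move: uT; rewrite !inE /= => /andP.
have dV x : x \in FV d -> x \notin vars T by move/fdisjointP: dis; apply.
have dVc x c : c \in cor T -> x \in FV c -> x \notin FV d.
  by move=> cT xc; apply/negP => /dV; rewrite (FV_vars cT xc).
have zu : z != u by apply: contraTneq zd => ->; apply/negP => /dV; rewrite uV.
have [c0 c0T uc0] := varsP _ _ uV.
have c0d : c0 != d by apply: contraNneq (dVc _ _ c0T uc0) => <-.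
have memT' c : (c \in cor T') = (c == d) || (c \in cor T) by rewrite cT' !inE.
have dT' : d \in cor T' by rewrite memT' eqxx.
have cT'T c : c \in cor T -> c \in cor T' by rewrite memT' orbC => ->.
have ndT c : c \in cor T -> z \notin FV c by move=> cT; apply: contraL (dVc z c cT) _; rewrite zd.
have vT' x : x \in vars T' -> x \in vars T \/ x \in FV d.
  case/varsP=> c; rewrite memT' => /predU1P[->|cT] xc; first by right.
  by left; apply: FV_vars xc.
have vdT' x : x \in FV d -> x \in vars T' by apply: FV_vars.
have vTT' x : x \in vars T -> x \in vars T'.
  by case/varsP=> c cT; apply: FV_vars; apply: cT'T.
have unu x : x \in vars T -> x != u -> inv T x != u.
  by move=> xT; apply: contraNneq => e; rewrite -(Tii x xT) e uu.
have T'g : is_graph T'.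
  split.
  - by apply/fset0Pn; exists d.
  - move=> c c'; rewrite !memT' => /predU1P[->|cT] /predU1P[->|c'T] cc'.
    + by rewrite eqxx in cc'.
    + by apply/fdisjointP => x; apply: contraL; apply: dVc.
    + by apply/fdisjointP => x; apply: dVc.
    + exact: Td.
  - move=> x /vT'[xT|xd].
      have [->|xu] := eqVneq x u; first by rewrite iu vdT'.
      by rewrite iT // vTT' // Ti.
    have [->|xz] := eqVneq x z; first by rewrite iz vTT'.
    by rewrite id' // vdT'.
  - move=> x /vT'[xT|xd].
      have [->|xu] := eqVneq x u; first by rewrite iu.
      by rewrite iT // iT ?Ti ?unu // Tii.
    have [->|xz] := eqVneq x z; first by rewrite iz.
    by rewrite !id'.
have adjE : {in cor T &, adj T =2 adj T'}.
  move=> c c' cT c'T; rewrite /adj cT c'T !cT'T //=.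
  apply: eq_existsb => -[x /= xc]; have xV := FV_vars cT xc.
  have [->|xu] := eqVneq x u; last by rewrite iT.
  by rewrite iu uu eqxx andbF (negPf (ndT _ c'T)).
have adj_d c : c \in cor T -> (adj T' c d = (c == c0)) * (adj T' d c = (c == c0)).
  move=> cT; rewrite /adj (cT'T _ cT) dT' /=; split.
    apply/existsP/eqP => [[[x /= xc] /andP[xd _]]|cc0].
      have xu : x = u.
        apply: contraTeq xd => xu; rewrite iT ?(FV_vars cT xc) //.
        by apply/negP => /dV; rewrite Ti // (FV_vars cT xc).
      by subst x; apply: (FV_inj Tg cT c0T xc uc0).
    by subst c; exists [` uc0]; rewrite /= iu zd zu.
  apply/existsP/eqP => [[[x /= xd] /andP[xc _]]|cc0].
    have xz : x = z.
      by apply: contraTeq xc => xz; rewrite id' //; apply: contraL xd; apply: dVc.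
    by subst x; rewrite iz in xc; apply: (FV_inj Tg cT c0T xc uc0).
  by subst c; exists [` zd]; rewrite /= iz uc0 eq_sym zu.
have adj_dd : adj T' d d = false.
  apply/negP => /and3P[_ _ /existsP[[/= x xd] /andP[]]].
  have [->|xz] := eqVneq x z; last by rewrite id' // eqxx.
  by rewrite iz => /dV; rewrite uV.
split=> //; split.
- have conT c c' : c \in cor T -> c' \in cor T ->
      exists2 p, path (adj T') c p & c' = last c p.
    move=> cT c'T; have [p pp ->] := Tc _ _ cT c'T; exists p => //.
    elim: p c cT pp => //= e p IHp c cT /andP[ce ep].
    have eT : e \in cor T by case/and3P: ce.
    by rewrite -adjE // ce IHp.
  move=> c c'; rewrite !memT' => /predU1P[->|cT] /predU1P[->|c'T].
  + by exists [::].
  + have [p pp ->] := conT _ _ c0T c'T; exists (c0 :: p) => //=.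
    by rewrite (adj_d c0 c0T).2 eqxx.
  + have [p pp pe] := conT _ _ cT c0T; exists (rcons p d); last by rewrite last_rcons.
    by rewrite rcons_path pp -pe (adj_d c0 c0T).1 eqxx.
  + exact: conT.
- move=> c; rewrite memT' => /predU1P[->|cT] x xc ixc.
    have [xz|xz] := eqVneq x z; last exact: id'.
    by move: ixc; rewrite xz iz => /dV; rewrite uV.
  have xV := FV_vars cT xc.
  have [xu|xu] := eqVneq x u; last by move: ixc; rewrite iT //; apply: Tl.
  by move: ixc; rewrite xu iu (negPf (ndT _ cT)).
- move=> c c'; rewrite !memT' => /predU1P[->|cT] /predU1P[->|c'T] x y cc' xc yc.
  + by rewrite eqxx in cc'.
  + have aux v : v \in FV d -> inv T' v \in FV c' -> v = z.
      move=> vd; apply: contraTeq => vz; rewrite id' //.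
      by apply: contraL vd; apply: dVc.
    by move=> /(aux _ xc) -> /(aux _ yc) ->.
  + have aux v : v \in FV c -> inv T' v \in FV d -> v = u.
      move=> vc; apply: contraTeq => vu; have vV := FV_vars cT vc.
      by rewrite iT //; apply/negP => /dV; rewrite Ti.
    by move=> /(aux _ xc) -> /(aux _ yc) ->.
  + have aux v : v \in FV c -> inv T' v \in FV c' -> inv T' v = inv T v.
      move=> vc; have [->|vu] := eqVneq v u; last by rewrite iT // (FV_vars cT vc).
      by rewrite iu (negPf (ndT _ c'T)).
    move=> xc' yc'; move: (xc') (yc'); rewrite (aux _ xc xc') (aux _ yc yc').
    exact: Tm cc' xc yc.
- move=> s s2 us; apply/negP => cs.
  have [ds|ds] := boolP (d \in s); last first.
    have sT : all (mem (cor T)) s.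
      apply/allP => c cs'; have := next_cycle cs cs'.
      case/and3P; rewrite memT' => /predU1P[cd|//].
      by rewrite -cd cs' in ds.
    have := Ty s s2 us; rewrite (sub_in_cycle _ sT cs) // => c c' cT c'T.
    by rewrite adjE.
  (* Rotated to begin at [d], the cycle has [c0] both as second and as last entry; these are
     distinct positions because its length exceeds two. *)
  have [i s' rs] := rot_to ds.
  move: s2 us cs; rewrite -(size_rot i) -(rot_uniq i) -(rot_cycle i) rs.
  case: s' {rs} => [|c1 [|c2 s']] //= _ /and4P[dc1 c1s _ _].
  have nT c : adj T' d c -> c = c0.
    move=> h; have := h; case/and3P=> _; rewrite memT' => /predU1P[cd|cT] _.
      by rewrite cd adj_dd in h.
    by move: h; rewrite (adj_d _ cT).2 => /eqP.
  have nT' c : adj T' c d -> c = c0.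
    move=> h; have := h; case/and3P; rewrite memT' => /predU1P[cd|cT] _ _.
      by rewrite cd adj_dd in h.
    by move: h; rewrite (adj_d _ cT).1 => /eqP.
  rewrite rcons_path => /and4P[/nT e1 _ _ /nT' e2].
  by move/negP: c1s; apply; rewrite e1 -e2 mem_last.
Qed.

Definition swp x y v : V := if v == x then y else if v == y then x else v.

Definition tree1 a : graph E := Graph [fset a] id.

Definition tree2 a x y b : graph E := Graph [fset a; b] (swp x y).

Definition tree3 a x y b u z c : graph E :=
  Graph [fset a; b; c]
    (fun v => if (v == x) || (v == y) then swp x y v else swp u z v).

Lemma swpC x y : swp x y =1 swp y x.
Proof. by move=> v; rewrite /swp; case: eqVneq => [->|//]; case: eqVneq. Qed.

Lemma vars_tree1 a : vars (tree1 a) = FV a.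
Proof.
apply/fsetP => x; apply/varsP/idP => [[c /fset1P -> //]|xa].
by exists a; rewrite ?inE.
Qed.

Lemma free_tree1 a : free (tree1 a) = FV a.
Proof. by apply/fsetP => x; rewrite !inE /= vars_tree1 eqxx andbT. Qed.

Lemma tree1_etree a : is_etree (tree1 a).
Proof. exact: (@single_etree _ _ _ a). Qed.

Lemma vars_tree2 a x y b : vars (tree2 a x y b) = FV a `|` FV b.
Proof.
apply/fsetP => v; rewrite inE; apply/varsP/orP => [[c /fset2P[]->]|]; [by left|by right|].
by case=> h; [exists a|exists b]; rewrite // !inE eqxx ?orbT.
Qed.

Lemma free_tree2 a x y b : fdisjoint (FV a) (FV b) -> x \in FV a -> y \in FV b ->
  free (tree2 a x y b) = (FV a `\ x) `|` (FV b `\ y).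
Proof.
move=> /fdisjointP ab xa yb; apply/fsetP => v.
rewrite !inE /= vars_tree2 !inE /swp; have xb := ab x xa.
have ya : y \notin FV a by apply: contraL yb; apply: ab.
have xy : y != x by apply: contraNneq ya => ->.
have [->|vx] := eqVneq v x; first by rewrite (negPf xy) (negPf xb) !andbF.
have [->|vy] := eqVneq v y; first by rewrite eq_sym (negPf xy) (negPf ya) !andbF.
by rewrite eqxx andbT.
Qed.

Lemma tree2_etree a x y b : fdisjoint (FV a) (FV b) -> x \in FV a -> y \in FV b ->
  is_etree (tree2 a x y b).
Proof.
move=> ab xa yb; have yx : y != x.
  by move/fdisjointP: ab => /(_ x xa); apply: contraNneq => <-.
apply: (@attach_etree (tree1 a) _ b x y (tree1_etree a)); rewrite ?free_tree1 //.
- by rewrite vars_tree1 fdisjoint_sym.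
- by rewrite /= fsetUC.
- by rewrite /= /swp eqxx.
- by rewrite /= /swp (negPf yx) eqxx.
- move=> v; rewrite vars_tree1 /= /swp => va /negPf ->; case: eqVneq => // vy.
  by move/fdisjointP: ab => /(_ v va); rewrite vy yb.
- move=> v vb /= vy; rewrite /swp (negPf vy); case: eqVneq => // vx.
  by move/fdisjointP: ab => /(_ x xa); rewrite -vx vb.
Qed.

Lemma tree3_etree a x y b u z c :
  fdisjoint (FV a) (FV b) -> fdisjoint (FV a) (FV c) -> fdisjoint (FV b) (FV c) ->
  x \in FV a -> y \in FV b -> u \in FV b -> z \in FV c -> y != u ->
  is_etree (tree3 a x y b u z c).
Proof.
move=> ab ac bc xa yb ub zc yu.
have na v : v \in FV a -> (v \notin FV b) * (v \notin FV c).
  by move=> va; split; [move/fdisjointP: ab|move/fdisjointP: ac]; apply.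
have nb v : v \in FV b -> v \notin FV c by move/fdisjointP: bc; apply.
have ux : u != x by apply: contraTneq ub => ->; rewrite na.
have zx : z != x by apply: contraTneq zc => ->; rewrite na.
have zy : z != y by apply: contraTneq zc => ->; rewrite nb.
have zu : z != u by apply: contraTneq zc => ->; rewrite nb.
apply: (@attach_etree (tree2 a x y b) _ c u z (tree2_etree ab xa yb)).
- by rewrite vars_tree2 fdisjointXU fdisjoint_sym ac fdisjoint_sym.
- by rewrite free_tree2 // !inE (eq_sym u y) yu ub orbT.
- exact: zc.
- by rewrite /= fsetUC.
- by rewrite /= /swp eqxx (negPf ux) (eq_sym u y) (negPf yu).
- by rewrite /= /swp eqxx (negPf zx) (negPf zy) (negPf zu).
- move=> v; rewrite vars_tree2 /= => vab vu; case: ifP => // /norP[vx vy].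
  rewrite /swp (negPf vx) (negPf vy) (negPf vu); case: eqVneq => // vz.
  by move: vab; rewrite inE vz => /orP[/na[_]|/nb]; rewrite zc.
- move=> v vc vz /=; have vx : v != x by apply: contraTneq vc => ->; rewrite na.
  have vy : v != y by apply: contraTneq vc => ->; rewrite nb.
  have vu : v != u by apply: contraTneq vc => ->; rewrite nb.
  by rewrite (negPf vx) (negPf vy) /swp (negPf vu) (negPf vz).
Qed.

End SmallTrees.

(** * Flattening a tree with two corollas *)

Section Flattening.

Variables (V : choiceType) (C : species V).
Implicit Types (R U : graph C) (k : corolla (TT C)) (x y v : V).

Definition represents R k : Prop :=
  if k is @Ord _ _ X q then class_set (q : T_ C X) R else False.

Lemma represents_free R k : represents R k -> free R = FV k.
Proof. by case: k => // X q /T_mem[]. Qed.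

Lemma tree2_utree x y (E : species V) (a b : corolla E) :
  fdisjoint (FV a) (FV b) -> x \in FV a -> y \in FV b -> is_ord a -> is_ord b ->
  is_utree (tree2 a x y b).
Proof.
move=> ab xa yb oa ob; split; first exact: tree2_etree.
by left=> c /fset2P[]->.
Qed.

(** Grafting [R1] and [R2] along [x] and [y] flattens the tree with two corollas. It serves both
    (A1), with a two-corolla tree and a corolla, and (U1), with a corolla and a special corolla. *)
Lemma flattens_tree2 k1 k2 x y R1 R2 U :
  represents R1 k1 -> represents R2 k2 -> fdisjoint (vars R1) (vars R2) ->
  x \in free R1 -> y \in free R2 -> cor U = cor R1 `|` cor R2 ->
  {in vars R1, forall v, inv U v = if v == x then y else inv R1 v} ->
  {in vars R2, forall v, inv U v = if v == y then x else inv R2 v} ->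
  [/\ flattens (tree2 k1 x y k2) U, is_utree (tree2 k1 x y k2) &
      free U = free (tree2 k1 x y k2)].
Proof.
move=> r1 r2 dis x1 y2 cU i1 i2.
have f1 := represents_free r1; have f2 := represents_free r2.
have n1 v : v \in vars R1 -> v \notin vars R2 by move/fdisjointP: dis; apply.
have n2 v : v \in vars R2 -> v \notin vars R1 by apply: contraL; apply: n1.
have dk : fdisjoint (FV k1) (FV k2).
  apply/fdisjointP => v; rewrite -f1 -f2 => /free_vars/n1.
  by apply: contra; apply: free_vars.
have xk : x \in FV k1 by rewrite -f1.
have yk : y \in FV k2 by rewrite -f2.
have xV1 := free_vars x1; have yV2 := free_vars y2.
have yx : y != x by apply: contraTneq yV2 => ->; apply: n1.
have ord k R : represents R k -> is_ord k by case: k.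
have Tu : is_utree (tree2 k1 x y k2) by apply: tree2_utree; rewrite ?(ord _ _ r1) ?(ord _ _ r2).
have k12 : k1 != k2.
  by apply/eqP => e; move/fdisjointP: dk => /(_ x xk); rewrite -e xk.
split=> //; last first.
  rewrite free_tree2 // -f1 -f2; apply/fsetP => v; rewrite !inE /=.
  have -> : (v \in vars U) = (v \in vars R1) || (v \in vars R2).
    apply/varsP/orP => [[c]|[/varsP[c cR vc]|/varsP[c cR vc]]].
    - by rewrite cU inE => /orP[] cR vc; [left|right]; apply: FV_vars vc.
    - by exists c; rewrite // cU inE cR.
    - by exists c; rewrite // cU inE cR orbT.
  have [v1|v1] := boolP (v \in vars R1).
    rewrite i1 // (negPf (n1 _ v1)) /= andbF orbF.
    by case: (eqVneq v x) => [->|]; rewrite // (negPf yx).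
  have [v2|v2] := boolP (v \in vars R2); last by rewrite /= ?andbF.
  rewrite i2 // andbF /=.
  by case: (eqVneq v y) => [->|]; rewrite // eq_sym (negPf yx).
right; split; first by move=> k /fset2P[]->; rewrite ?(ord _ _ r1) ?(ord _ _ r2).
exists (fun k => if k == k1 then R1 else R2); split.
- have rk k : k \in [fset k1; k2] -> represents (if k == k1 then R1 else R2) k.
    by case/fset2P=> ->; rewrite ?eqxx // eq_sym (negPf k12).
  by move=> Y q /rk.
- move=> c d /fset2P[]-> /fset2P[]->; rewrite ?eqxx // (eq_sym k2) (negPf k12) //.
  by rewrite fdisjoint_sym.
- rewrite cU; apply/fsetP => c; rewrite inE; apply/orP/bigfcupP.
    case=> h; [exists k1|exists k2]; rewrite ?eqxx //= ?inE ?eqxx ?orbT //.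
    by rewrite eq_sym (negPf k12).
  case=> k /andP[/fset2P[]-> _]; rewrite ?eqxx; first by left.
  by rewrite eq_sym (negPf k12); right.
- move=> c /fset2P[]-> v; rewrite ?eqxx ?(eq_sym k2) ?(negPf k12) => vR.
    rewrite i1 //= /swp; case: eqVneq => [->|vx]; first by rewrite x1.
    have vy : v != y by apply: contraTneq vR => ->; apply: n2.
    case: ifP => //; rewrite !inE /= => /andP[_ /eqP ->]; by rewrite (negPf vy).
  rewrite i2 //= /swp; have vx : v != x by apply: contraTneq vR => ->; apply: n1.
  rewrite (negPf vx); case: eqVneq => [->|vy]; first by rewrite y2.
  by case: ifP => //; rewrite !inE /= => /andP[_ /eqP ->].
Qed.

End Flattening.

(** * Values of trees under an algebra structure *)

Section OperadOfAlgebra.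

Variables (V : choiceType) (C : species V) (M : M_algebra C).
Hypothesis Vinf : infinite_set [set: V]%classic.
Implicit Types (X Y : {fset V}) (x y z u v : V) (r : V -> V).
Implicit Types (c d e : elt C) (T U S : graph C).

Local Notation delta := (ma_delta M).

(** A relation between trees and packed elements, so that trees whose sets of free variables are
    only provably equal can be compared. *)
Definition dv T e : Prop :=
  exists X (q : T_ C X), class_set q T /\ e = elm (delta X q).

Lemma dv_supp T e : dv T e -> supp e = free T.
Proof. by case=> X [q [/T_mem[_ fT _] ->]]. Qed.

Lemma dv_uniq T e e' : dv T e -> dv T e' -> e = e'.
Proof.
move=> [X [q [/T_mem[_ fT qE] ->]]] [X' [q' [/T_mem[_ fT' q'E] ->]]].
have XX' : X' = X by rewrite -fT -fT'.
by clear fT'; subst X'; have -> : q = q' by apply: class_inj; rewrite qE q'E.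
Qed.

Definition utree_class (E : species V) (T : graph E) (Tu : is_utree T) : T_ E (free T) :=
  Class (ex_intro (fun U : graph E => [/\ is_utree U, free U = free T & alpha_class T = alpha_class U])
    T (And3 Tu erefl erefl)).

Lemma mem_utree_class (E : species V) (T : graph E) (Tu : is_utree T) :
  class_set (utree_class Tu) T.
Proof. by apply: alpha_refl; case: Tu => [[]]. Qed.

Lemma dv_ex T : is_utree T -> exists e, dv T e.
Proof.
move=> Tu; exists (elm (delta _ (utree_class Tu))), (free T), (utree_class Tu).
by split=> //; apply: mem_utree_class.
Qed.

(** Naturality of [delta]. When [r] fixes the free variables, it yields invariance under change of
    bound variables. *)
Lemma dv_renaming r T T' e : dv T e -> renaming r T T' -> dv T' (rn r e).
Proof.
move=> [X [q [qT ->]]] rT; have [[[Tg _] _] fT _] := T_mem qT.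
have rI : {in X &, injective r}.
  by case: rT => rI _ _ x y; rewrite -fT => xX yX; apply: rI; apply: free_vars.
have [s sE] := bij_of_renaming rI.
exists (r @` X), ((q : TT C X) ^^ s); split; first by exists T => //; exists r.
by rewrite nt_nat (rnE _ sE).
Qed.

(** Such graphs may differ as records, by the values of the involution off their variables, but the
    identity renaming makes them alpha-equivalent. *)
Lemma dv_eq T T' e : cor T' = cor T -> {in vars T, inv T' =1 inv T} ->
  dv T e -> dv T' e.
Proof.
move=> cT iT Te; rewrite -(@rn_id _ _ id e) //; apply: dv_renaming (Te) _.
case: Te => X [q [/T_mem[[[Tg _] _] _ _] _]].
have [_ rC _] := renaming_id (in1W (frefl id)) Tg.
by split=> // c'; rewrite cT.
Qed.

Lemma dv_eta e : dv (tree1 (ord e)) e.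
Proof.
exists (supp e), (eta (tagged e)); rewrite ma_eta taggedE; split=> //.
by apply: alpha_refl; case: (tree1_etree (ord e)).
Qed.

(** Compatibility with the multiplication, for flattenings that are in normal form or one reduction
    away from it: the former gives (A1), the latter (U1). *)
Lemma dv_mu (T : graph (TT C)) U S e : is_utree T -> flattens T U ->
  is_etree U -> free U = free T -> is_utree S -> free S = free T ->
  U = S \/ step U S -> dv (graph_map delta T) e -> dv S e.
Proof.
move=> Tu TU Ue fU Su fS US Te.
pose t : TT (TT C) (free T) := utree_class Tu.
have [Ug _] := Ue.
pose s : TT C (free T) := Class (ex_intro
  (fun U => [/\ is_utree U, free U = free T & alpha_class S = alpha_class U])
  S (And3 Su fS erefl)).
pose u : eT C (free T) := Class (ex_intro
  (fun U' => [/\ is_etree U', free U' = free T & alpha_class U = alpha_class U'])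
  U (And3 Ue fU erefl)).
pose w : eT C (free T) := Class (ex_intro
  (fun U' => [/\ is_etree U', free U' = free T & alpha_class S = alpha_class U'])
  S (And3 Su.1 fS erefl)).
have [Sg _] := Su.1.
have sS : class_set s S by apply: alpha_refl.
have uU : class_set u U by apply: alpha_refl.
have st : is_mu t s.
  exists u; first by exists T, U; split=> //; apply: mem_utree_class.
  exists w => //; case: US => [US|st]; last first.
    apply: reduces_step uU _ st (reduces_refl _); exact: alpha_refl.
  by have -> : u = w; [apply: class_inj; rewrite /= US|apply: reduces_refl].
exists (free T), s; split=> //; rewrite -(ma_mu M st).
apply: (dv_uniq Te); exists (free T), (T_hom delta t); split=> //.
exists T; first exact: mem_utree_class.
by apply: alpha_refl; have [[]] := graph_map_utree delta Tu.
Qed.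

Lemma fresh (F : {fset V}) : exists x, x \notin F.
Proof.
apply: contrapT => h; apply: Vinf; apply: (@sub_finite_set _ _ [set` F]%classic).
  by move=> x _ /=; apply: contrapT => /negP xF; apply: h; exists x.
exact: finite_fset.
Qed.

(** * Partial composition by separation of variables *)

Definition tree_elt c x y d : graph C := tree2 (ord c) x y (ord d).

Lemma FV_ord c : FV (ord c) = supp c.
Proof. by []. Qed.

Lemma tree_elt_utree c x y d : fdisjoint (supp c) (supp d) ->
  x \in supp c -> y \in supp d -> is_utree (tree_elt c x y d).
Proof. by move=> cd xc yd; apply: tree2_utree. Qed.

Lemma supp_rnP r c v : {in supp c &, injective r} ->
  v \in supp (rn r c) -> exists2 w, w \in supp c & v = r w.
Proof. by move=> rI; rewrite supp_rn // => /imfsetP[w /= wc ->]; exists w. Qed.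

Lemma renaming_tree_elt r c x y d : x \in supp c -> y \in supp d ->
  {in supp c `|` supp d &, injective r} ->
  renaming r (tree_elt c x y d) (tree_elt (rn r c) (r x) (r y) (rn r d)).
Proof.
move=> xc yd rI.
have rIc : {in supp c &, injective r}.
  by move=> v w vc wc; apply: rI; rewrite inE ?vc ?wc.
have rId : {in supp d &, injective r}.
  by move=> v w vc wc; apply: rI; rewrite inE ?vc ?wc orbT.
split.
- by rewrite vars_tree2.
- move=> c'; split=> [/fset2P[]->|[a /fset2P[]-> aC]].
  + by exists (ord c); [rewrite !inE eqxx|apply: rnP].
  + by exists (ord d); [rewrite !inE eqxx orbT|apply: rnP].
  + by rewrite (ren_cor_inj aC (rnP rIc)) !inE eqxx.
  + by rewrite (ren_cor_inj aC (rnP rId)) !inE eqxx orbT.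
- move=> v; rewrite vars_tree2 /= /swp => vV.
  have xV : x \in supp c `|` supp d by rewrite inE xc.
  have yV : y \in supp c `|` supp d by rewrite inE yd orbT.
  have rE w : w \in supp c `|` supp d -> (r v == r w) = (v == w).
    by move=> wV; apply/eqP/eqP => [/rI->|->].
  by rewrite !rE //; case: ifP => // _; case: ifP.
Qed.

(** The two corollas are renamed independently, and [r] carries one pair of renamings to another. *)
Lemma dv_tree_elt r r1 r2 r1' r2' c x y d e : x \in supp c -> y \in supp d ->
  {in supp c &, injective r1} -> {in supp d &, injective r2} ->
  {in supp c &, injective r1'} -> {in supp d &, injective r2'} ->
  (forall v w, v \in supp c -> w \in supp d -> r1' v <> r2' w) ->
  {in supp c, forall v, r (r1 v) = r1' v} -> {in supp d, forall v, r (r2 v) = r2' v} ->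
  dv (tree_elt (rn r1 c) (r1 x) (r2 y) (rn r2 d)) e ->
  dv (tree_elt (rn r1' c) (r1' x) (r2' y) (rn r2' d)) (rn r e).
Proof.
move=> xc yd I1 I2 I1' I2' dis E1 E2 Te; apply: (dv_renaming Te).
rewrite -(E1 _ xc) -(E2 _ yd).
have -> : rn r1' c = rn r (rn r1 c).
  rewrite rn_comp //; last by move=> v w vc wc /=; rewrite !E1 //; apply: I1'.
  by apply: eq_rn => v vc /=; rewrite E1.
have -> : rn r2' d = rn r (rn r2 d).
  rewrite rn_comp //; last by move=> v w vc wc /=; rewrite !E2 //; apply: I2'.
  by apply: eq_rn => v vc /=; rewrite E2.
apply: renaming_tree_elt; rewrite ?supp_rn ?in_imfset //.
move=> v w /fsetUP[] /imfsetP[/= v' v'c ->] /fsetUP[] /imfsetP[/= w' w'c ->].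
- by rewrite !E1 // => /I1' ->.
- by rewrite E1 // E2 // => /(dis _ _ v'c w'c).
- by rewrite E1 // E2 // => /esym /(dis _ _ w'c v'c).
- by rewrite !E2 // => /I2' ->.
Qed.

(* [r1] and [r2] make the variables of [c] and [d] disjoint by renaming only
   the variables [x] and [y] to be joined. *)
Definition separates r1 r2 c x y d : Prop :=
  [/\ {in supp c &, injective r1}, {in supp d &, injective r2},
      {in supp c, forall v, v != x -> r1 v = v},
      {in supp d, forall v, v != y -> r2 v = v} &
      forall v w, v \in supp c -> w \in supp d -> r1 v <> r2 w].

Definition ren1 x x' v : V := if v == x then x' else v.

Lemma ren1_inj x x' (F : {fset V}) : x' \notin F -> {in F &, injective (ren1 x x')}.
Proof.
move=> x'F v w vF wF; rewrite /ren1; case: eqVneq => [->|_]; case: eqVneq => [->|_] // e.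
  by move: x'F; rewrite e wF.
by move: x'F; rewrite -e vF.
Qed.

Lemma separates_ren1 c x y d x' y' : joinable c x y d ->
  x' \notin supp c `|` supp d -> y' \notin supp c `|` supp d -> x' != y' ->
  separates (ren1 x x') (ren1 y y') c x y d.
Proof.
move=> /and3P[xc yd /fdisjointP dis]; rewrite !inE !negb_or.
move=> /andP[xc' xd'] /andP[yc' yd'] xy; split; try exact: ren1_inj.
- by move=> v _ /negPf vx; rewrite /ren1 vx.
- by move=> v _ /negPf vx; rewrite /ren1 vx.
move=> v w vc wd; rewrite /ren1; case: eqVneq => [_|vx]; case: eqVneq => [_|wy].
- exact/eqP.
- by move=> e; rewrite e wd in xd'.
- by move=> e; rewrite -e vc in yc'.
move=> e; subst w; have := dis v; rewrite !inE vx vc => /(_ isT).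
by rewrite wy wd.
Qed.

Lemma separates_ex c x y d (F : {fset V}) : joinable c x y d -> exists x' y',
  [/\ separates (ren1 x x') (ren1 y y') c x y d, x' \notin F, y' \notin F & x' != y'].
Proof.
move=> J; have [x'] := fresh (F `|` (supp c `|` supp d)).
rewrite inE negb_or => /andP[x'F x'cd].
have [y'] := fresh (F `|` (x' |` (supp c `|` supp d))).
rewrite inE negb_or => /andP[y'F]; rewrite inE negb_or => /andP[y'x' y'cd].
have xy : x' != y' by rewrite eq_sym; move: y'x'; rewrite inE.
by exists x', y'; split=> //; apply: separates_ren1.
Qed.

(** One value serves all separations: two of them differ by a renaming of the joined variables, and
    these are not in the support of the value. *)
Lemma pcomp_ex c x y d : joinable c x y d -> exists e, forall r1 r2,
  separates r1 r2 c x y d -> dv (tree_elt (rn r1 c) (r1 x) (r2 y) (rn r2 d)) e.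
Proof.
move=> J; have := J; case/and3P=> xc yd cd.
have [x' [y' [sep x'F y'F xy]]] := separates_ex (supp c `|` supp d) J.
move: x'F y'F; rewrite !inE !negb_or => /andP[xc' xd'] /andP[yc' yd'].
have [I1 I2 n1 n2 dis] := sep.
pose a := rn (ren1 x x') c; pose b := rn (ren1 y y') d.
have xa : ren1 x x' x \in supp a by rewrite supp_rn // in_imfset.
have yb : ren1 y y' y \in supp b by rewrite supp_rn // in_imfset.
have ab : fdisjoint (supp a) (supp b).
  apply/fdisjointP => v /(supp_rnP I1)[v' v'c ->]; apply/negP => /(supp_rnP I2)[w wd].
  exact: dis.
have [e ve] := dv_ex (tree_elt_utree ab xa yb).
exists e => r1 r2 [J1 J2 m1 m2 dis'].
(* Carries the chosen fresh separation to the arbitrary one. *)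
pose r v := if v == x' then r1 x else if v == y' then r2 y else v.
suff <- : rn r e = e.
  apply: dv_tree_elt ve => //.
    move=> v vc; rewrite /r /ren1; case: (eqVneq v x) => [->|vx]; first by rewrite eqxx.
    have /negPf -> : v != x' by apply: contraNneq xc' => <-.
    have /negPf -> : v != y' by apply: contraNneq yc' => <-.
    by rewrite m1.
  move=> v vc; rewrite /r /ren1; case: (eqVneq v y) => [->|vx].
    by rewrite eq_sym (negPf xy) eqxx.
  have /negPf -> : v != x' by apply: contraNneq xd' => <-.
  have /negPf -> : v != y' by apply: contraNneq yd' => <-.
  by rewrite m2.
apply: rn_id => v; rewrite (dv_supp ve) free_tree2 //.
have -> : ren1 x x' x = x' by rewrite /ren1 eqxx.
have -> : ren1 y y' y = y' by rewrite /ren1 eqxx.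
rewrite /r; case: (eqVneq v x') => [->|vx].
  rewrite !inE eqxx /= => /andP[_ /(supp_rnP I2)[w wd]]; rewrite /ren1.
  case: ifP => [_ e'|_ e']; first by rewrite e' eqxx in xy.
  by rewrite e' wd in xd'.
case: (eqVneq v y') => [->|//]; rewrite !inE eqxx /= orbF.
case/andP=> _ /(supp_rnP I1)[w wd]; rewrite /ren1.
case: ifP => [_ e'|_ e']; first by rewrite e' eqxx in xy.
by rewrite e' wd in yc'.
Qed.

(* Junk value [c] when [joinable c x y d] fails. *)
Definition pcomp c x y d : elt C :=
  if pselect (joinable c x y d) is left J then projT1 (cid (pcomp_ex J)) else c.

Lemma pcompP c x y d r1 r2 : joinable c x y d -> separates r1 r2 c x y d ->
  dv (tree_elt (rn r1 c) (r1 x) (r2 y) (rn r2 d)) (pcomp c x y d).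
Proof.
by move=> J; rewrite /pcomp; case: pselect => // {}J; case: cid => e /= h; apply: h.
Qed.

Lemma joinable_disjoint c x y d : fdisjoint (supp c) (supp d) ->
  x \in supp c -> y \in supp d -> joinable c x y d.
Proof.
move=> /fdisjointP dis xc yd; rewrite /joinable xc yd; apply/fdisjointP => v.
by rewrite !inE => /andP[_ /dis/negPf->]; rewrite andbF.
Qed.

Lemma pcomp_disjoint c x y d : fdisjoint (supp c) (supp d) ->
  x \in supp c -> y \in supp d -> dv (tree_elt c x y d) (pcomp c x y d).
Proof.
move=> dis xc yd; rewrite -{1}(@rn_id _ _ id c) // -{1}(@rn_id _ _ id d) //.
apply: (@pcompP c x y d id id); first exact: joinable_disjoint.
by split=> // v w vc wd e; move/fdisjointP: dis => /(_ v vc); rewrite e wd.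
Qed.

Lemma supp_pcomp c x y d : joinable c x y d ->
  supp (pcomp c x y d) = (supp c `\ x) `|` (supp d `\ y).
Proof.
move=> J; have := J; case/and3P=> xc yd cd.
have [x' [y' [sep x'F y'F xy]]] := separates_ex (supp c `|` supp d) J.
have [I1 I2 n1 n2 dis] := sep.
have aux a z z' : z \in supp a -> z' \notin supp a ->
    (ren1 z z' @` supp a) `\ z' = supp a `\ z.
  move=> za z'a; apply/fsetP => v; rewrite !inE; apply/andP/andP.
    case=> vz /imfsetP[/= w wa ve]; move: ve vz; rewrite /ren1.
    by case: (eqVneq w z) => [_ ->|wz ->]; rewrite ?eqxx.
  case=> vz va; split; first by apply: contraNneq z'a => <-.
  by apply/imfsetP; exists v; rewrite //= /ren1 (negPf vz).
move: x'F y'F; rewrite !inE !negb_or => /andP[xc' xd'] /andP[yc' yd'].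
rewrite (dv_supp (pcompP J sep)) free_tree2.
- rewrite !FV_ord !supp_rn // /ren1 !eqxx -/(ren1 x x') -/(ren1 y y').
  by rewrite !aux.
- apply/fdisjointP => v /(supp_rnP I1)[v' v'c ->]; apply/negP => /(supp_rnP I2)[w wd].
  exact: dis.
- by rewrite FV_ord supp_rn // in_imfset.
- by rewrite FV_ord supp_rn // in_imfset.
Qed.

(** Contains (EQ), since [r] has to agree with [r1] and [r2] only off the joined variables. With [r]
    the identity it says that the names of the joined variables do not matter. Both sides are
    computed with the same fresh [x'] and [y']. *)
Lemma pcomp_rn r r1 r2 c x y d : joinable c x y d ->
  {in supp c &, injective r1} -> {in supp d &, injective r2} ->
  joinable (rn r1 c) (r1 x) (r2 y) (rn r2 d) ->
  {in supp c, forall v, v != x -> r v = r1 v} ->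
  {in supp d, forall v, v != y -> r v = r2 v} ->
  pcomp (rn r1 c) (r1 x) (r2 y) (rn r2 d) = rn r (pcomp c x y d).
Proof.
move=> J I1 I2 J' E1 E2; have := J; case/and3P=> xc yd cd.
have [x' [y' [sep' x'F y'F xy]]] := separates_ex (supp c `|` supp d) J'.
have sep := separates_ren1 J x'F y'F xy.
move: x'F y'F; rewrite !inE !negb_or => /andP[xc' xd'] /andP[yc' yd'].
have [K1 K2 _ _ _] := sep; have [K1' K2' _ _ dis] := sep'.
have L1 : {in supp c &, injective (ren1 (r1 x) x' \o r1)}.
  by move=> v w vc wc /= /K1' e; apply: (I1) => //; apply: e; rewrite supp_rn // in_imfset.
have L2 : {in supp d &, injective (ren1 (r2 y) y' \o r2)}.
  by move=> v w vc wc /= /K2' e; apply: (I2) => //; apply: e; rewrite supp_rn // in_imfset.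
have := pcompP J' sep'; rewrite (rn_comp I1 L1) (rn_comp I2 L2) => /dv_uniq; apply.
(* Nothing is known of [r] at [x'] and [y'], so it is corrected there; neither occurs in the
   composite. *)
pose p v := if v == x' then x' else if v == y' then y' else r v.
have -> : rn r (pcomp c x y d) = rn p (pcomp c x y d).
  apply: eq_rn => v; rewrite supp_pcomp // /p => vS.
  have /negPf -> : v != x'.
    by apply: contraTneq vS => ->; rewrite !inE (negPf xc') (negPf xd') !andbF.
  have /negPf -> // : v != y'.
  by apply: contraTneq vS => ->; rewrite !inE (negPf yc') (negPf yd') !andbF.
apply: (dv_tree_elt (r1' := ren1 (r1 x) x' \o r1) (r2' := ren1 (r2 y) y' \o r2)
  _ _ K1 K2 L1 L2 _ _ _ (pcompP J sep)) => //.
- by move=> v w vc wd; apply: dis; rewrite supp_rn // in_imfset.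
- move=> v vc; rewrite /p /= /ren1; case: (eqVneq v x) => [->|vx]; first by rewrite !eqxx.
  have /negPf -> : v != x' by apply: contraNneq xc' => <-.
  have /negPf -> : v != y' by apply: contraNneq yc' => <-.
  rewrite E1 //; case: eqVneq => // /(I1 _ _ vc xc) e; by rewrite e eqxx in vx.
- move=> v vd; rewrite /p /= /ren1; case: (eqVneq v y) => [->|vy].
    by rewrite eq_sym (negPf xy) !eqxx.
  have /negPf -> : v != x' by apply: contraNneq xd' => <-.
  have /negPf -> : v != y' by apply: contraNneq yd' => <-.
  rewrite E2 //; case: eqVneq => // /(I2 _ _ vd yd) e; by rewrite e eqxx in vy.
Qed.

Lemma joinable_sym c x y d : joinable c x y d -> joinable d y x c.
Proof. by case/and3P=> xc yd cd; rewrite /joinable xc yd fdisjoint_sym. Qed.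

(** Both sides are values of the same unordered two-corolla tree. *)
Lemma pcompC c x y d : joinable c x y d -> pcomp c x y d = pcomp d y x c.
Proof.
move=> J; have [x' [y' [sep _ _ xy]]] := separates_ex fset0 J.
have sep' : separates (ren1 y y') (ren1 x x') d y x c.
  by case: sep => I1 I2 n1 n2 dis; split=> // v w vd wc /esym; apply: dis.
apply: (dv_uniq (pcompP J sep)).
apply: dv_eq (pcompP (joinable_sym J) sep') => /=; first by rewrite fsetUC.
by move=> v _; rewrite swpC.
Qed.

(** * Associativity from trees with three corollas *)

Lemma mem_eta e : represents (tree1 (ord e)) (Ord (eta (tagged e))).
Proof. by apply: alpha_refl; case: (tree1_etree (ord e)). Qed.

(** The three-corolla tree flattens a tree with two corollas, whose parameters are the tree of [a]
    and [b] and the unit [eta] at [c]; applying [delta] to these parameters yields the iterated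
    composite. *)
Lemma dv_tree3 a b c x y u z :
  fdisjoint (supp a) (supp b) -> fdisjoint (supp a) (supp c) ->
  fdisjoint (supp b) (supp c) ->
  x \in supp a -> y \in supp b -> u \in supp b -> z \in supp c -> y != u ->
  dv (tree3 (ord a) x y (ord b) u z (ord c)) (pcomp (pcomp a x y b) u z c).
Proof.
move=> ab ac bc xa yb ub zc yu.
have [X [q [qT qE]]] := pcomp_disjoint ab xa yb.
have na v : v \in supp a -> (v \notin supp b) * (v \notin supp c).
  by move=> va; split; [move/fdisjointP: ab|move/fdisjointP: ac]; apply.
have nb v : v \in supp b -> v \notin supp c by move/fdisjointP: bc; apply.
have ux : u != x by apply: contraTneq ub => ->; rewrite na.
pose S := tree3 (ord a) x y (ord b) u z (ord c).
have vab : vars (tree_elt a x y b) = supp a `|` supp b by rewrite vars_tree2.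
have f12 : u \in free (tree_elt a x y b).
  by rewrite free_tree2 // !inE /= ub (eq_sym u y) yu orbT.
have := @flattens_tree2 _ _ (Ord (q : TT C X)) (Ord (eta (tagged c))) u z
  (tree_elt a x y b) (tree1 (ord c)) S qT (mem_eta c).
rewrite vab vars_tree1 free_tree1 fdisjointUX ac bc => /(_ isT f12 zc).
case=> [||v vc|TS Tu fS].
- by [].
- move=> v vV /=; rewrite /swp; case: (eqVneq v u) => [->|vu].
    by rewrite (negPf ux) (eq_sym u y) (negPf yu).
  case: ifP => // /norP[/negPf-> /negPf->]; case: eqVneq => // vz.
  by move: vV; rewrite inE vz => /orP[/na[_]|/nb]; rewrite zc.
- have vx : v != x by apply: contraTneq vc => ->; rewrite na.
  have vy : v != y by apply: contraTneq vc => ->; rewrite nb.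
  have vu : v != u by apply: contraTneq vc => ->; rewrite nb.
  by rewrite /= /swp (negPf vx) (negPf vy) (negPf vu).
have Se : is_etree S by apply: tree3_etree.
have Su : is_utree S by split=> //; left=> k; rewrite !inE -orbA => /or3P[] /eqP->.
apply: (dv_mu Tu TS Se fS Su fS (or_introl erefl)).
have Jab := joinable_disjoint ab xa yb.
have : dv (tree_elt (pcomp a x y b) u z c) (pcomp (pcomp a x y b) u z c).
  apply: pcomp_disjoint => //; rewrite supp_pcomp //; last first.
    by rewrite !inE ub (eq_sym u y) yu orbT.
  apply/fdisjointP => v; rewrite !inE => /orP[] /andP[_]; first by case/na.
  exact: nb.
apply: dv_eq => //=; rewrite imfsetU !imfset_fset1 /= qE; congr (_ `|` [fset _]).
by rewrite ma_eta.
Qed.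

(** By commutativity the right-hand side is the composite of [c], [b], [a] in this order, that is,
    the value of the same three-corolla tree read from its other end. *)
Lemma pcompA_disjoint a b c x y u z :
  fdisjoint (supp a) (supp b) -> fdisjoint (supp a) (supp c) ->
  fdisjoint (supp b) (supp c) ->
  x \in supp a -> y \in supp b -> u \in supp b -> z \in supp c -> y != u ->
  pcomp (pcomp a x y b) u z c = pcomp a x y (pcomp b u z c).
Proof.
move=> ab ac bc xa yb ub zc yu.
have Jbc := joinable_disjoint bc ub zc.
have Jabc : joinable a x y (pcomp b u z c).
  apply: joinable_disjoint; rewrite ?supp_pcomp //; last by rewrite !inE yb yu.
  apply/fdisjointP => v va; rewrite !inE.
  have /negPf-> : v \notin supp b by move/fdisjointP: ab; apply.
  have /negPf-> : v \notin supp c by move/fdisjointP: ac; apply.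
  by rewrite !andbF.
apply: (dv_uniq (dv_tree3 ab ac bc xa yb ub zc yu)).
rewrite (pcompC Jabc) (pcompC Jbc).
have := @dv_tree3 c b a z u y x; rewrite !(fdisjoint_sym (supp c)) (fdisjoint_sym _ (supp a)).
move/(_ bc ac ab zc ub yb xa); rewrite eq_sym => /(_ yu); apply: dv_eq => /=.
  by apply/fsetP => k; rewrite !inE; case: (k == ord a); case: (k == ord b);
    case: (k == ord c).
move=> v _ /=; rewrite (swpC z u) (swpC y x) orbC.
have na w : w \in supp a -> (w \notin supp b) * (w \notin supp c).
  by move=> wa; split; [move/fdisjointP: ab|move/fdisjointP: ac]; apply.
have nb w : w \in supp b -> w \notin supp c by move/fdisjointP: bc; apply.
have xu : x != u by apply: contraTneq ub => <-; rewrite na.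
have xz : x != z by apply: contraTneq zc => <-; rewrite na.
have yz : y != z by apply: contraTneq zc => <-; rewrite nb.
rewrite /swp; case: (eqVneq v x) => [->|vx].
  by rewrite orbT (negPf xu) (negPf xz).
case: (eqVneq v y) => [->|vy]; first by rewrite (negPf yu) (negPf yz).
by case: eqVneq => // _; case: eqVneq.
Qed.

(** All four joined variables receive fresh names, which makes the three supports disjoint; the law
    is then carried back. *)
Lemma pcompA c x y d u z e : joinable c x y d -> joinable d u z e ->
  joinable (pcomp c x y d) u z e -> joinable c x y (pcomp d u z e) -> y != u ->
  pcomp (pcomp c x y d) u z e = pcomp c x y (pcomp d u z e).
Proof.
move=> J1 J2 J3 J4 yu; have := J1; case/and3P=> xc yd /fdisjointP cd.
have := J2; case/and3P=> ud ze /fdisjointP de.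
have := J4; case/and3P=> _ _ /fdisjointP cde.
pose F := supp c `|` supp d `|` supp e.
have [x' x'F] := fresh F; have [y'] := fresh (x' |` F).
rewrite in_fset1U negb_or => /andP[yx' y'F].
have [u'] := fresh (x' |` (y' |` F)); rewrite !in_fset1U !negb_or => /and3P[ux' uy' u'F].
have [z'] := fresh (x' |` (y' |` (u' |` F))).
rewrite !in_fset1U !negb_or => /and4P[zx' zy' zu' z'F].
have FN v : v \notin F -> [/\ v \notin supp c, v \notin supp d & v \notin supp e].
  by rewrite !inE !negb_or -andbA => /and3P.
have FE v w : v \in F -> w \notin F -> (v == w) = false.
  by move=> vF; apply: contraNF => /eqP <-.
have cF v : v \in supp c -> v \in F by rewrite !inE => ->.
have dF v : v \in supp d -> v \in F by rewrite !inE => ->; rewrite orbT.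
have eF v : v \in supp e -> v \in F by rewrite !inE => ->; rewrite orbT.
have [x'c x'd x'e] := FN _ x'F; have [y'c y'd y'e] := FN _ y'F.
have [u'c u'd u'e] := FN _ u'F; have [z'c z'd z'e] := FN _ z'F.
have cdN v : v \in supp c -> v != x -> v \in supp d -> v != y -> False.
  by move=> vc vx vd vy; have := cd v; rewrite !inE vc vx vd vy => /(_ isT).
have deN v : v \in supp d -> v != u -> v \in supp e -> v != z -> False.
  by move=> vd vu ve vz; have := de v; rewrite !inE vd vu ve vz => /(_ isT).
(* Joinability of [c] with the composite of [d] and [e] leaves only [v = y], which [deN] excludes
   since [y] remains in [d] after deleting [u]. *)
have ceN v : v \in supp c -> v != x -> v \in supp e -> v != z -> False.
  move=> vc vx ve vz; have := cde v; rewrite supp_pcomp // !inE vc vx ve vz => /(_ isT).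
  by rewrite orbT andbT negbK => /eqP vy; subst v; apply: (deN y).
pose r1 := ren1 x x'; pose r3 := ren1 z z'.
(* The middle element is joined at two variables, so both are renamed. *)
pose r2 v := if v == y then y' else if v == u then u' else v.
have I1 : {in supp c &, injective r1} by apply: ren1_inj.
have I3 : {in supp e &, injective r3} by apply: ren1_inj.
have I2 : {in supp d &, injective r2}.
  have r2y v : v \in supp d -> r2 v = y' -> v = y.
    move=> vd; rewrite /r2; case: eqVneq => // _; case: eqVneq => [_ h|_ h].
      by rewrite h eqxx in uy'.
    by move: y'd; rewrite -h vd.
  have r2u v : v \in supp d -> r2 v = u' -> v = u.
    move=> vd; rewrite /r2; case: eqVneq => [_ h|_].
      by rewrite h eqxx in uy'.
    by case: eqVneq => // _ h; move: u'd; rewrite -h vd.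
  move=> v w vd wd; rewrite {1}/r2; case: eqVneq => [-> /esym/(r2y _ wd)//|vy].
  case: eqVneq => [-> /esym/(r2u _ wd)//|vu]; rewrite /r2.
  case: eqVneq => [_ h|_]; first by move: y'd; rewrite -h vd.
  by case: eqVneq => [_ h|//]; move: u'd; rewrite -h vd.
pose c' := rn r1 c; pose d' := rn r2 d; pose e' := rn r3 e.
have cd' : fdisjoint (supp c') (supp d').
  apply/fdisjointP => _ /(supp_rnP I1)[v vc ->]; apply/negP => /(supp_rnP I2)[w wd].
  rewrite /r1 /r2 /ren1; case: eqVneq => vx; case: eqVneq => wy.
  - by move=> h; rewrite h eqxx in yx'.
  - by case: eqVneq => [_ h|_ h]; [rewrite h eqxx in ux'|move: x'd; rewrite h wd].
  - by move=> h; move: y'c; rewrite -h vc.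
  case: eqVneq => [_ h|_ h]; first by move: u'c; rewrite -h vc.
  by subst w; apply: cdN wy.
have ce' : fdisjoint (supp c') (supp e').
  apply/fdisjointP => _ /(supp_rnP I1)[v vc ->]; apply/negP => /(supp_rnP I3)[w we].
  rewrite /r1 /r3 /ren1; case: eqVneq => vx; case: eqVneq => wz.
  - by move=> h; rewrite h eqxx in zx'.
  - by move=> h; move: x'e; rewrite h we.
  - by move=> h; move: z'c; rewrite -h vc.
  by move=> h; subst w; apply: ceN wz.
have de' : fdisjoint (supp d') (supp e').
  apply/fdisjointP => _ /(supp_rnP I2)[v vd ->]; apply/negP => /(supp_rnP I3)[w we].
  rewrite /r2 /r3 /ren1; case: (eqVneq v y) => vy; case: (eqVneq w z) => wz.
  - by move=> h; rewrite h eqxx in zy'.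
  - by move=> h; move: y'e; rewrite h we.
  - by case: eqVneq => [_ h|_ h]; [rewrite h eqxx in zu'|move: z'd; rewrite -h vd].
  case: (eqVneq v u) => [_ h|vu h]; first by move: u'e; rewrite h we.
  by subst w; apply: deN wz.
have xc' : r1 x \in supp c' by rewrite supp_rn // in_imfset.
have yd' : r2 y \in supp d' by rewrite supp_rn // in_imfset.
have ud' : r2 u \in supp d' by rewrite supp_rn // in_imfset.
have ze' : r3 z \in supp e' by rewrite supp_rn // in_imfset.
have yu' : r2 y != r2 u by apply: contra yu => /eqP /I2 ->.
have Jcd' := joinable_disjoint cd' xc' yd'; have Jde' := joinable_disjoint de' ud' ze'.
(* The variable [u] is still free in this composite, so its new name remains visible; likewise [y]
   in the next one. *)
have e1 : pcomp c' (r1 x) (r2 y) d' = rn (ren1 u u') (pcomp c x y d).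
  apply: pcomp_rn => // v vS vx; rewrite /ren1 /r1 /r2 ?(negPf vx) //.
  rewrite /ren1 (negPf vx); case: eqVneq => // vu; subst v.
  by case: (cdN u) => //; rewrite eq_sym.
have e2 : pcomp d' (r2 u) (r3 z) e' = rn (ren1 y y') (pcomp d u z e).
  apply: pcomp_rn => // v vS vx; rewrite /r3 /r2 /ren1 ?(negPf vx) //.
  by case: eqVneq => // vy; subst v; case: (deN y).
have := pcompA_disjoint cd' ce' de' xc' yd' ud' ze' yu'.
have u2 : r2 u = ren1 u u' u by rewrite /r2 /ren1 eqxx eq_sym (negPf yu).
have y2 : r2 y = ren1 y y' y by rewrite /r2 /ren1 eqxx.
have Ja : joinable (pcomp c' (r1 x) (r2 y) d') (r2 u) (r3 z) e'.
  apply: joinable_disjoint => //; rewrite supp_pcomp //; last first.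
    by rewrite !inE ud' (eq_sym (r2 u) (r2 y)) yu' orbT.
  apply/fdisjointP => v; rewrite !inE => /orP[] /andP[_].
    by move/fdisjointP: ce'; apply.
  by move/fdisjointP: de'; apply.
have Jb : joinable c' (r1 x) (r2 y) (pcomp d' (r2 u) (r3 z) e').
  apply: joinable_disjoint => //; rewrite supp_pcomp //; last first.
    by rewrite !inE yd' yu'.
  apply/fdisjointP => v vc; rewrite !inE.
  have /negPf-> : v \notin supp d' by move/fdisjointP: cd'; apply.
  have /negPf-> : v \notin supp e' by move/fdisjointP: ce'; apply.
  by rewrite !andbF.
rewrite e1 e2 u2 y2; rewrite e1 u2 in Ja; rewrite e2 y2 in Jb.
(* In the outer composites only joined variables are renamed, so the identity describes the effect
   on the result. *)
rewrite (@pcomp_rn id) //; last 3 first.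
- by apply: ren1_inj; rewrite supp_pcomp // !inE (negPf u'c) (negPf u'd) !andbF.
- by move=> v _ vu; rewrite /ren1 (negPf vu).
- by move=> v _ vz; rewrite /r3 /ren1 (negPf vz).
rewrite (@pcomp_rn id) //; last 3 first.
- by apply: ren1_inj; rewrite supp_pcomp // !inE (negPf y'd) (negPf y'e) !andbF.
- by move=> v _ vu; rewrite /r1 /ren1 (negPf vu).
- by move=> v _ vz; rewrite /ren1 (negPf vz).
by rewrite !rn_id.
Qed.

(** * Units from exceptional trees *)

Lemma tree1_spec_utree X (h : #|` X| == 2) : is_utree (tree1 (Spec h : corolla C)).
Proof. by split; [apply: tree1_etree|right; exists (Spec h)]. Qed.

Definition unit_tree X (h : #|` X| == 2) : T_ C X :=
  Class (ex_intro (fun T => [/\ is_utree T, free T = X &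
      alpha_class (tree1 (Spec h : corolla C)) = alpha_class T])
    (tree1 (Spec h)) (And3 (tree1_spec_utree h) (free_tree1 (Spec h)) erefl)).

Lemma mem_unit_tree X (h : #|` X| == 2) : class_set (unit_tree h) (tree1 (Spec h)).
Proof. by apply: alpha_refl; case: (tree1_etree (Spec h : corolla C)). Qed.

Definition punit X (h : #|` X| == 2) : C X := delta X (unit_tree h).

Lemma dv_punit X (h : #|` X| == 2) : dv (tree1 (Spec h)) (elm (punit h)).
Proof. by exists X, (unit_tree h); split=> //; apply: mem_unit_tree. Qed.

(** A special corolla has no parameter, so its renaming is just the special corolla on the new
    pair. *)
Lemma rn_punit r X X' (h : #|` X| == 2) (h' : #|` X'| == 2) :
  {in X &, injective r} -> X' = r @` X -> rn r (elm (punit h)) = elm (punit h').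
Proof.
move=> rI X'E; apply: dv_uniq (dv_punit h'); apply: dv_renaming (dv_punit h) _.
split=> //; first by rewrite vars_tree1.
move=> c'; rewrite inE; split=> [/eqP->|[c /fset1P->]].
  by exists (Spec h); rewrite ?inE.
have hh' : ren_cor r (Spec h : corolla C) (Spec h') by [].
by move=> /ren_cor_inj/(_ hh') ->; rewrite eqxx.
Qed.

Lemma punit_map X X' (h : #|` X| == 2) (h' : #|` X'| == 2) (s : bij X' X) :
  punit h ^^ s = punit h'.
Proof.
have [r rI rE] := bij_extend s; apply: elm_inj.
by rewrite -(rnE _ rE); apply: rn_punit; [apply: in2W|apply: bij_renaming_dom rE].
Qed.

(** The corolla of [c] joined to a special one is the flattening [U] of a tree with parameters
    [eta f] and the unit tree. One reduction leads to the single corolla [S] of the renamed element,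
    whose value is given by the unit law of the algebra. *)
Lemma pcomp_punit_disjoint c x y z (h : #|` [fset y; z]| == 2) :
  fdisjoint (supp c) [fset y; z] -> x \in supp c ->
  pcomp c x y (elm (punit h)) = rn (ren1 x z) c.
Proof.
case: c => X f; rewrite -/(elm f) => dis xc.
have yz : y != z by move: (h); rewrite cardfs2; case: (y != z).
have yyz : y \in [fset y; z] by rewrite !inE eqxx.
have nX v : v \in X -> (v != y) * (v != z).
  move=> vX; move/fdisjointP: dis => /(_ v vX); rewrite !inE negb_or.
  by case/andP=> -> ->.
have zX : z \notin X by apply/negP => /nX[_]; rewrite eqxx.
have onto : X `\ x `|` [fset z] = ren1 x z @` X.
  apply/fsetP => v; rewrite !inE; apply/orP/imfsetP => /=.
    case=> [/andP[vx vX]|/eqP->]; first by exists v; rewrite // /ren1 (negPf vx).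
    by exists x; rewrite // /ren1 eqxx.
  case=> w wX ->; rewrite /ren1; case: (eqVneq w x) => [_|wx]; first by right.
  by left; rewrite wx wX.
have [t tE] := bij_onto (ren1_inj zX) onto.
have tr : renames t.
  move=> v; move: (tE v) (fsvalP (t v)); rewrite /= /ren1; case: eqVneq => [-> <- _|_ <- vX].
    by rewrite eqxx.
  by rewrite (negPf (nX _ vX).2).
rewrite (rnE f tE); pose c := elm f; pose S := tree1 (Ord (f ^^ t)).
pose U := tree2 (ord c) x y (Spec h).
have := @flattens_tree2 _ _ (Ord (eta f)) (Ord (unit_tree h : TT C _)) x y
  (tree1 (ord c)) (tree1 (Spec h)) U (mem_eta c) (mem_unit_tree h).
rewrite !vars_tree1 !free_tree1 => /(_ dis xc yyz erefl) [v vX|v vX|TU Tu fU].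
- rewrite /= /swp; case: eqVneq => // _; by rewrite (negPf (nX _ vX).1).
- rewrite /= /swp; case: eqVneq => // vx.
  by move: vX; rewrite vx !inE (negPf (nX _ xc).1) (negPf (nX _ xc).2).
have Ue : is_etree U by apply: tree2_etree.
have Su : is_utree S.
  by split; [apply: tree1_etree|left=> k /fset1P->].
have fS : free S = free (tree2 (Ord (eta f)) x y (Ord (unit_tree h : TT C _))).
  rewrite free_tree1 free_tree2 //=; congr (_ `|` _); apply/fsetP => v; rewrite !inE.
  by case: (eqVneq v y) => [->|//]; rewrite (negPf yz).
have US : step U S.
  apply: (@step_ord _ _ U S X f x y z h t) => //.
  - by rewrite !inE eqxx.
  - by rewrite !inE eqxx orbT.
  - by rewrite /= /swp eqxx.
  - apply/fsetP => k; rewrite !inE; case: eqVneq => //= _.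
    by case: (k == Spec h); case: (k == Ord f).
  move=> v; rewrite vars_tree1 /= /swp !inE => /orP[/andP[/negPf-> vX]|/eqP->].
    by rewrite (negPf (nX _ vX).1).
  rewrite (eq_sym z y) (negPf yz); case: eqVneq => // zx.
  by move: zX; rewrite zx xc.
apply/esym/(dv_uniq (dv_eta (elm (f ^^ t)))).
apply: (dv_mu Tu TU Ue fU Su fS (or_intror US)).
have := @pcomp_disjoint c x y (elm (punit h)) dis xc yyz; apply: dv_eq => //=.
by rewrite imfsetU !imfset_fset1 /= ma_eta.
Qed.

(** Here [y] may occur in [c], and [z] may be [x]. Fresh names for [x] and [y] reduce to disjoint
    supports, and renaming [x] to [x'] and then [x'] to [z] amounts to renaming [x] to [z]. *)
Lemma pcomp_punit c x y z (h : #|` [fset y; z]| == 2) :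
  joinable c x y (elm (punit h)) -> pcomp c x y (elm (punit h)) = rn (ren1 x z) c.
Proof.
move=> J; have := J; case/and3P=> xc _ _.
have yz : y != z by move: (h); rewrite cardfs2; case: (y != z).
have [x' [y' [sep]]] := separates_ex (supp c `|` [fset y; z]) J.
rewrite !inE !negb_or => /and3P[x'c x'y x'z] /and3P[y'c y'y y'z] xy'.
have h' : #|` [fset y'; z]| == 2 by rewrite cardfs2 y'z.
have [I1 I2 n1 n2 dis] := sep.
have yzE : [fset y'; z] = ren1 y y' @` [fset y; z].
  by rewrite imfsetU !imfset_fset1 /ren1 eqxx eq_sym (negPf yz).
have uE : rn (ren1 y y') (elm (punit h)) = elm (punit h') by apply: rn_punit.
have z2 : ren1 y y' z = z by rewrite /ren1 eq_sym (negPf yz).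
have y2 : ren1 y y' y = y' by rewrite /ren1 eqxx.
have x2 : ren1 x x' x = x' by rewrite /ren1 eqxx.
have d' : fdisjoint (supp (rn (ren1 x x') c)) [fset y'; z].
  apply/fdisjointP => _ /(supp_rnP I1)[v vc ->]; rewrite yzE; apply/imfsetP => -[/= w wyz].
  exact: dis.
have x'c' : x' \in supp (rn (ren1 x x') c) by rewrite supp_rn // -{1}x2 in_imfset.
have <- : pcomp (rn (ren1 x x') c) x' y' (elm (punit h')) = pcomp c x y (elm (punit h)).
  have := @pcomp_rn id _ _ c x y (elm (punit h)) J I1 I2.
  rewrite x2 y2 uE (@rn_id _ _ id) // => -> //.
  - by apply: joinable_disjoint; rewrite // !inE eqxx.
  - by move=> v vc vx; rewrite n1.
  - by move=> v vc vx; rewrite n2.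
rewrite pcomp_punit_disjoint // rn_comp //.
  apply: eq_rn => v vc; rewrite /= /ren1; case: (eqVneq v x) => [_|vx].
    by rewrite eqxx.
  by case: eqVneq => // vx'; move: x'c; rewrite -vx' vc.
have zN : z \notin supp (rn (ren1 x x') c).
  apply/negP => /(supp_rnP I1)[v vc]; rewrite -z2 => /esym; apply: dis => //.
  by rewrite !inE eqxx orbT.
by move=> v w vc wc /= /(ren1_inj zN) e; apply: (I1) => //; apply: e;
  rewrite supp_rn // in_imfset.
Qed.

(** * The cyclic operad, back on the indexed sets *)

Lemma joinableI X Y x y (f : C X) (g : C Y) : x \in X -> y \in Y ->
  fdisjoint (X `\ x) (Y `\ y) -> joinable (elm f) x y (elm g).
Proof. by move=> xX yY d; rewrite /joinable xX yY. Qed.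

Definition op_comp X Y x y (xX : x \in X) (yY : y \in Y)
    (d : fdisjoint (X `\ x) (Y `\ y)) (f : C X) (g : C Y) :
    C ((X `\ x) `|` (Y `\ y)) :=
  elt_cast (supp_pcomp (joinableI f g xX yY d)).

Lemma op_compE X Y x y (xX : x \in X) (yY : y \in Y)
    (d : fdisjoint (X `\ x) (Y `\ y)) (f : C X) (g : C Y) :
  elm (op_comp xX yY d f g) = pcomp (elm f) x y (elm g).
Proof. exact: elt_castE. Qed.

Lemma operad_of_algebra : cyclic_operad C.
Proof.
apply: (@CyclicOperad _ C punit op_comp).
- move=> X Y Z x y u z f g h xX yY uY zZ dXY uXY dXYZ dYZ yYZ dX_YZ yu.
  rewrite -!/(elm _) !op_compE; apply: pcompA; rewrite // -1?(op_compE xX yY dXY)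
    -1?(op_compE uY zZ dYZ); exact: joinableI.
- move=> X Y x y f g xX yY dXY dYX.
  by rewrite -!/(elm _) !op_compE; apply: pcompC; apply: joinableI.
- move=> X Y X' Y' s1 s2 x y f g dXY dXY' s [g1 g2].
  (* The inverses of the three bijections are extended to injections of V; [glues] then says that
     [r] agrees with [r1] off [x] and with [r2] off [y], as [pcomp_rn] requires. *)
  have [r1 I1 E1] := bij_extend s1; have [r2 I2 E2] := bij_extend s2.
  have [r I E] := bij_extend s.
  apply: elm_inj; rewrite op_compE -(rnE _ E) op_compE.
  have rx : val (bij_inv s1 x) = r1 (val x) by rewrite -E1 bij_invK.
  have ry : val (bij_inv s2 y) = r2 (val y) by rewrite -E2 bij_invK.
  have J := joinableI (f ^^ s1) (g ^^ s2) (valP (bij_inv s1 x)) (valP (bij_inv s2 y)) dXY'.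
  rewrite -(rnE f E1) -(rnE g E2) rx ry in J *.
  apply: pcomp_rn => //; try exact: in2W.
  + exact: joinableI (valP x) (valP y) dXY.
  + move=> v vX vx; pose w := bij_inv s1 [` vX].
    have wv : val (s1 w) = v by rewrite bij_invK.
    have wx : val w != val (bij_inv s1 x).
      by apply: contra vx => /eqP e; rewrite -wv (val_inj e) bij_invK.
    have wZ : val w \in X' `\ val (bij_inv s1 x) `|` Y' `\ val (bij_inv s2 y).
      by rewrite in_fsetU in_fsetD1 wx fsvalP.
    by rewrite -wv E1 -(g1 [` wZ] w erefl wx) E.
  + move=> v vY vy; pose w := bij_inv s2 [` vY].
    have wv : val (s2 w) = v by rewrite bij_invK.
    have wy : val w != val (bij_inv s2 y).
      by apply: contra vy => /eqP e; rewrite -wv (val_inj e) bij_invK.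
    have wZ : val w \in X' `\ val (bij_inv s1 x) `|` Y' `\ val (bij_inv s2 y).
      by rewrite in_fsetU; apply/orP; right; rewrite in_fsetD1 wy fsvalP.
    by rewrite -wv E2 -(g2 [` wZ] w erefl wy) E.
- move=> X x y z f xX yz cyz d s sr; rewrite -!/(elm _) op_compE.
  rewrite pcomp_punit; last exact: joinableI.
  apply: rnE => v; rewrite sr /ren1; case: (eqVneq (val v) z) => [->|vz].
    by rewrite eqxx.
  have := fsvalP v; rewrite !inE => /orP[/andP[/negPf-> //]|e].
  by rewrite /= e in vz.
- move=> X X' cX cX' s; exact: punit_map.
Qed.

End OperadOfAlgebra.

Theorem theorem1 (V : choiceType) (C : species V) :
  infinite_set [set: V]%classic ->
  inhabited (cyclic_operad C) <-> inhabited (M_algebra C).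
Proof.
move=> Vinf; split=> -[A]; constructor; first exact: algebra_of_operad A.
exact: operad_of_algebra A Vinf.
Qed.
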